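(* Let $R$ be a noetherian normal integral domain with fraction field $K$, and let $A$ be an $R$-algebra that is finitely generated and flat as an $R$-module and such that $A^K=K\otimes_R A$ is a split $K$-algebra. Let $Z=\mathrm{Z}(A)$ be the center of $A$ and let $\Upsilon:\operatorname{Spec}(Z)\to\operatorname{Spec}(R)$ be the morphism induced by $R\to Z$. For a simple $A^K$-module $S$ let $\Omega'_S:Z\to R$ be the restriction of its central character, and for $\mathfrak{p}\in\operatorname{Spec}(R)$ let $\Omega_S^{\mathfrak{p}}:Z\to R/\mathfrak{p}$ be the composition of $\Omega'_S$ with the quotient map $R\to R/\mathfrak{p}$. Then for every $\mathfrak{p}\in\operatorname{Spec}(R)$: (1) under the canonical bijection between $\Upsilon^{-1}(\mathfrak{p})$ and the set of $\mathfrak{p}$-families of $A^K$ (described in the context), the $\mathfrak{p}$-family of a simple $A^K$-module $S$ corresponds to $\operatorname{Ker}\Omega_S^{\mathfrak{p}}$; (2) hence two simple $A^K$-modules $S$ and $T$ lie in the same $\mathfrak{p}$-family (i.e. in the same $A_{\mathfrak{p}}$-block) if and only if $\Omega'_S(z)\equiv\Omega'_T(z)\bmod\mathfrak{p}$ for all $z\in Z$. (3) Consequently, if $z_1,\ldots,z_n$ generate $Z$ as an $R$-algebra and $\mathscr{F},\mathscr{F}'$ are two distinct families of $A^K$, then the gluing locus of $\mathscr{F}$ and $\mathscr{F}'$ is $$\mathrm{Gl}_A(\{\mathscr{F},\mathscr{F}'\})=\mathrm{V}\big(\{\Omega_{\mathscr{F}}(z_i)-\Omega_{\mathscr{F}'}(z_i)\mid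 i=1,\ldots,n\}\big)\subseteq\operatorname{Spec}(R).$$
   Context: Block idempotents of a ring are its centrally-primitive idempotents. A module $V$ belongs to the block of a block idempotent $c$ if $cV=V$. The families of $A^K$ are the sets of (isomorphism classes of) simple $A^K$-modules belonging to a common block of $A^K$. For $\mathfrak{p}\in\operatorname{Spec}(R)$ the map $A_{\mathfrak{p}}\to A^K$ is injective; the block idempotents $c$ of $A_{\mathfrak{p}}$ are pairwise orthogonal central idempotents of $A^K$ with sum $1$, and the $\mathfrak{p}$-families of $A^K$ are the sets $\{S \text{ simple } A^K\text{-module}\mid cS=S\}$ for $c$ a block idempotent of $A_{\mathfrak{p}}$; each $\mathfrak{p}$-family is a union of families of $A^K$. The canonical bijection between $\mathfrak{p}$-families and $\Upsilon^{-1}(\mathfrak{p})$ sends the $\mathfrak{p}$-family of a block idempotent $c$ of $A_{\mathfrak{p}}$ to the unique prime ideal $\mathfrak{Q}$ of $Z$ lying over $\mathfrak{p}$ with $1-c\in\mathfrak{Q}_{\mathfrak{p}}$ (the extension of $\mathfrak{Q}$ to $Z_{\mathfrak{p}}=R_{\mathfrak{p}}\otimes_R Z=\mathrm{Z}(A_{\mathfrak{p}})$). Since $A^K$ splits, each $z\in\mathrm{Z}(A^K)$ acts on a simple $A^K$-module $S$ by a scalar $\Omega_S(z)\in K$; since $R$ is normal, $\Omega_S$ maps $Z$ into $R$, giving the $R$-algebra morphism $\Omega'_S:Z\to R$. One has $\Omega'_S=\Omega'_T$ iff $S,T$ lie in the same family of $A^K$, so one writes $\Omega_{\mathscr{F}}:Z\to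 R$ for $\Omega'_S$ with $S\in\mathscr{F}$. The gluing locus $\mathrm{Gl}_A(\{\mathscr{F},\mathscr{F}'\})$ is the set of all $\mathfrak{p}\in\operatorname{Spec}(R)$ such that $\mathscr{F}$ and $\mathscr{F}'$ are contained in the same $\mathfrak{p}$-family, i.e. the corresponding blocks of $A^K$ lie in the same block of $A_{\mathfrak{p}}$. $\mathrm{V}(\cdot)$ denotes the zero locus in $\operatorname{Spec}(R)$. A finite-dimensional algebra over a field is split if all its simple modules remain simple under every extension of the base field. *)

(* Defs.v *)
From HB Require Import structures.
From mathcomp Require Import all_boot all_order all_algebra.
From mathcomp Require Import boolp classical_sets.

Set Implicit Arguments.
Unset Strict Implicit.
Unset Printing Implicit Defensive.

Import GRing.Theory.

Local Open Scope ring_scope.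
Local Open Scope quotient_scope.

Definition restr (R B : pzRingType) (f : {rmorphism R -> B})
  (V : lmodType B) : Type := V.

Section RestrictionOfScalars.
Variables (R B : pzRingType) (f : {rmorphism R -> B}) (V : lmodType B).

Local Notation rV := (restr f V).
HB.instance Definition _ := GRing.Zmodule.on rV.

Let scale (r : R) (v : rV) : rV := (f r *: (v : V)) : V.

Lemma restr_scaleA a b v : scale a (scale b v) = scale (a * b) v.
Proof. by rewrite /scale scalerA rmorphM. Qed.
Lemma restr_scale1 : left_id 1 scale.
Proof. by move=> v; rewrite /scale rmorph1 scale1r. Qed.
Lemma restr_scaleDr : right_distributive scale +%R.
Proof. by move=> a u v; rewrite /scale scalerDr. Qed.
Lemma restr_scaleDl v : {morph scale^~ v : a b / a + b}.
Proof. by move=> a b; rewrite /scale rmorphD scalerDl. Qed.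

HB.instance Definition _ := GRing.Zmodule_isLmodule.Build R rV
  restr_scaleA restr_scale1 restr_scaleDr restr_scaleDl.

Lemma restr_scaleE (r : R) (v : rV) : r *: v = f r *: (v : V).
Proof. by []. Qed.

End RestrictionOfScalars.

(* Algebras are not required to be nonzero, contrary to [algType R]: there is  *)
(* no way to know a priori that a tensor product of algebras is nonzero.       *)
Record ralg (R : comPzRingType) := RAlg {
  ralg_ring :> pzRingType;
  ralg_map : {rmorphism R -> ralg_ring};
  ralg_central : forall r a, ralg_map r * a = a * ralg_map r }.

Definition ralg_mod (R : comPzRingType) (A : ralg R) : lmodType R :=
  restr (ralg_map A) A^o.

Section TensorProduct.
Variables (R : comPzRingType) (M N : lmodType R).

(* A list of pairs stands for the sum of the corresponding pure tensors. *)
Inductive tens_rel : seq (M * N) -> seq (M * N) -> Prop :=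
| tens_refl s : tens_rel s s
| tens_sym s t : tens_rel s t -> tens_rel t s
| tens_trans s t u : tens_rel s t -> tens_rel t u -> tens_rel s u
| tens_cat s s' t t' :
    tens_rel s s' -> tens_rel t t' -> tens_rel (s ++ t) (s' ++ t')
| tens_comm s t : tens_rel (s ++ t) (t ++ s)
| tens_0l n : tens_rel [:: (0, n)] [::]
| tens_Dl m m' n : tens_rel [:: (m + m', n)] [:: (m, n); (m', n)]
| tens_Dr m n n' : tens_rel [:: (m, n + n')] [:: (m, n); (m, n')]
| tens_Z r m n : tens_rel [:: (r *: m, n)] [:: (m, r *: n)].

Definition tens_equiv : rel (seq (M * N)) := fun s t => `[< tens_rel s t >].

Lemma tens_equiv_class : equiv_class_of tens_equiv.
Proof.
split=> [s|s t|t s u]; first by apply/asboolP; apply: tens_refl.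
  by apply/asboolP/asboolP; apply: tens_sym.
by move=> /asboolP st /asboolP tu; apply/asboolP; apply: tens_trans st tu.
Qed.

Canonical tens_equiv_equiv := EquivRelPack tens_equiv_class.
Canonical tens_equiv_encModRel := defaultEncModRel tens_equiv.

Definition tensor : Type := {eq_quot tens_equiv}.
HB.instance Definition _ : EqQuotient _ tens_equiv tensor :=
  EqQuotient.on tensor.
HB.instance Definition _ := Choice.on tensor.

Lemma tensor_piP s t : (\pi_tensor s = \pi_tensor t) <-> tens_rel s t.
Proof.
split=> [/eqmodP /asboolP //|st].
by apply/eqmodP/asboolP.
Qed.

Lemma tens_repr s : tens_rel (repr (\pi_tensor s)) s.
Proof. by apply/tensor_piP; rewrite reprK. Qed.

Definition tens_opp_seq (s : seq (M * N)) := [seq (- x.1, x.2) | x <- s].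

Definition tens_zero : tensor := \pi_tensor [::].
Definition tens_add (x y : tensor) : tensor := \pi_tensor (repr x ++ repr y).
Definition tens_opp (x : tensor) : tensor := \pi_tensor (tens_opp_seq (repr x)).

Lemma tens_opp_rel s t :
  tens_rel s t -> tens_rel (tens_opp_seq s) (tens_opp_seq t).
Proof.
elim=> {s t} /=.
- by move=> s; apply: tens_refl.
- by move=> s t _; apply: tens_sym.
- by move=> s t u _ st _; apply: tens_trans st.
- by move=> s s' t t' _ Hs _ Ht; rewrite /tens_opp_seq !map_cat; apply: tens_cat.
- by move=> s t; rewrite /tens_opp_seq !map_cat; apply: tens_comm.
- by move=> n; rewrite oppr0; apply: tens_0l.
- by move=> m m' n; rewrite opprD; apply: tens_Dl.
- by move=> m n n'; apply: tens_Dr.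
- by move=> r m n; rewrite -scalerN; apply: tens_Z.
Qed.

Lemma tens_pi_add s t : tens_add (\pi_tensor s) (\pi_tensor t) = \pi_tensor (s ++ t).
Proof. by apply/tensor_piP; apply: tens_cat; apply: tens_repr. Qed.

Lemma tens_pi_opp s : tens_opp (\pi_tensor s) = \pi_tensor (tens_opp_seq s).
Proof. by apply/tensor_piP; apply: tens_opp_rel; apply: tens_repr. Qed.

Lemma tens_addA : associative tens_add.
Proof.
move=> x y z; rewrite -[x]reprK -[y]reprK -[z]reprK.
move: (repr x) (repr y) (repr z) => {x y z} s t u.
by rewrite (tens_pi_add t u) (tens_pi_add s t) !tens_pi_add catA.
Qed.

Lemma tens_addC : commutative tens_add.
Proof.
move=> x y; rewrite -[x]reprK -[y]reprK.
move: (repr x) (repr y) => {x y} s t.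
by rewrite (tens_pi_add s t) (tens_pi_add t s); apply/tensor_piP; apply: tens_comm.
Qed.

Lemma tens_add0 : left_id tens_zero tens_add.
Proof. by move=> x; rewrite -[x]reprK (tens_pi_add [::] (repr x)). Qed.

Lemma tens_addN : left_inverse tens_zero tens_opp tens_add.
Proof.
move=> x; rewrite -[x]reprK; move: (repr x) => {x} s.
rewrite (tens_pi_opp s) (tens_pi_add (tens_opp_seq s) s).
elim: s => [|[m n] s IHs] //=.
have Hz : tens_add (\pi_tensor [:: (- m, n)]) (\pi_tensor [:: (m, n)]) = tens_zero.
  rewrite (tens_pi_add [:: (- m, n)] [:: (m, n)]); apply/tensor_piP.
  apply: tens_trans (tens_sym (tens_Dl (- m) m n)) _.
  by rewrite addNr; apply: tens_0l.
rewrite -cat1s -(cat1s _ s) -(tens_pi_add [:: (- m, n)]).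
rewrite -(tens_pi_add (tens_opp_seq s)) -(tens_pi_add [:: (m, n)]).
rewrite (tens_addC (\pi_tensor [:: (m, n)])).
rewrite (tens_addA (\pi_tensor (tens_opp_seq s))).
by rewrite (tens_pi_add (tens_opp_seq s)) IHs tens_add0.
Qed.

HB.instance Definition _ := GRing.isZmodule.Build tensor
  tens_addA tens_addC tens_add0 tens_addN.

Definition tens (m : M) (n : N) : tensor := \pi_tensor [:: (m, n)].

Lemma tensor_ind (P : tensor -> Prop) :
  P 0 -> (forall m n, P (tens m n)) -> (forall x y, P x -> P y -> P (x + y)) ->
  forall x, P x.
Proof.
move=> P0 Pt PD x; rewrite -[x]reprK; elim: (repr x) => [//|[m n] s IHs].
rewrite -cat1s -(tens_pi_add [:: (m, n)]); exact: (PD _ _ (Pt m n) IHs).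
Qed.

Lemma tensDl m m' n : tens (m + m') n = tens m n + tens m' n.
Proof.
by rewrite [RHS]tens_pi_add; apply/tensor_piP; apply: tens_Dl.
Qed.

Lemma tensDr m n n' : tens m (n + n') = tens m n + tens m n'.
Proof.
by rewrite [RHS]tens_pi_add; apply/tensor_piP; apply: tens_Dr.
Qed.

Lemma tensZ r m n : tens (r *: m) n = tens m (r *: n).
Proof. by apply/tensor_piP; apply: tens_Z. Qed.

Section Lift.
Variables (V : zmodType) (f : M -> N -> V).

Definition balanced :=
  [/\ forall m m' n, f (m + m') n = f m n + f m' n,
      forall m n n', f m (n + n') = f m n + f m n' &
      forall r m n, f (r *: m) n = f m (r *: n)].

(* Only meaningful for balanced maps. *)
Definition tensor_lift (x : tensor) : V := \sum_(u <- repr x) f u.1 u.2.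

Hypothesis fP : balanced.

Lemma tensor_lift_pi s : tensor_lift (\pi_tensor s) = \sum_(u <- s) f u.1 u.2.
Proof.
have [fDl fDr fZ] := fP; rewrite /tensor_lift.
move: (repr _) (tens_repr s) => t; elim=> {s t} //=.
- by move=> t u v _ -> _ ->.
- by move=> t t' u u' _ Ht _ Hu; rewrite !big_cat Ht Hu.
- by move=> t u; rewrite !big_cat /= addrC.
- move=> n; rewrite big_seq1 big_nil /=.
  by apply: (addrI (f 0 n)); rewrite -fDl !addr0.
- by move=> m m' n; rewrite !big_cons !big_nil !addr0 /= fDl.
- by move=> m n n'; rewrite !big_cons !big_nil !addr0 /= fDr.
- by move=> r m n; rewrite !big_seq1 /= fZ.
Qed.

Lemma tensor_lift_tens m n : tensor_lift (tens m n) = f m n.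
Proof. by rewrite tensor_lift_pi big_seq1. Qed.

Lemma tensor_liftD : {morph tensor_lift : x y / x + y}.
Proof.
move=> x y; rewrite -[x]reprK -[y]reprK [_ + _]tens_pi_add.
by rewrite !tensor_lift_pi big_cat.
Qed.

Lemma tensor_lift0 : tensor_lift 0 = 0.
Proof. by have := tensor_lift_pi [::]; rewrite big_nil. Qed.

End Lift.

Definition tens_scale (r : R) : tensor -> tensor :=
  tensor_lift (fun m n => tens (r *: m) n).

Lemma tens_scale_balanced r : balanced (fun m n => tens (r *: m) n).
Proof.
split=> [m m' n|m n n'|a m n]; rewrite ?scalerDr ?tensDl ?tensDr //.
by rewrite -tensZ !scalerA mulrC.
Qed.

Let sb := tens_scale_balanced.

Lemma tens_scaleDr : right_distributive tens_scale +%R.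
Proof. by move=> r; apply: tensor_liftD. Qed.

Lemma tens_scaleA a b v : tens_scale a (tens_scale b v) = tens_scale (a * b) v.
Proof.
rewrite /tens_scale; elim/tensor_ind: v => [|m n|x y].
- by rewrite !tensor_lift0.
- by rewrite !tensor_lift_tens // scalerA.
- by rewrite !tensor_liftD // => -> ->.
Qed.

Lemma tens_scale1 : left_id 1 tens_scale.
Proof.
move=> v; rewrite /tens_scale; elim/tensor_ind: v => [|m n|x y].
- by rewrite !tensor_lift0.
- by rewrite !tensor_lift_tens // scale1r.
- by rewrite !tensor_liftD // => -> ->.
Qed.

Lemma tens_scaleDl v : {morph tens_scale^~ v : a b / a + b}.
Proof.
move=> a b; rewrite /tens_scale; elim/tensor_ind: v => [|m n|x y].
- by rewrite !tensor_lift0 ?addr0.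
- by rewrite !tensor_lift_tens // scalerDl tensDl.
- by rewrite !tensor_liftD // => -> ->; rewrite addrACA.
Qed.

HB.instance Definition _ := GRing.Zmodule_isLmodule.Build R tensor
  tens_scaleA tens_scale1 tens_scaleDr tens_scaleDl.

End TensorProduct.

Definition tensor_map (R : comPzRingType) (M M' N N' : lmodType R)
    (f : M -> M') (g : N -> N') : tensor M N -> tensor M' N' :=
  tensor_lift (fun m n => tens (f m) (g n)).

(* The action of B \otimes A on the tensor product of a B-module and an        *)
(* A-module; the product of B \otimes A is the case of regular modules.        *)
Section TensorAction.
Variables (R : comPzRingType) (B A : ralg R).

Definition tring : Type := tensor (ralg_mod B) (ralg_mod A).
HB.instance Definition _ := GRing.Zmodule.on tring.

Section Action.
Variables (M : lmodType B) (N : lmodType A).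

Definition tmod : Type :=
  tensor (restr (ralg_map B) M) (restr (ralg_map A) N).
HB.instance Definition _ := GRing.Zmodule.on tmod.

Definition tmtens (m : M) (n : N) : tmod :=
  tens (m : restr (ralg_map B) M) (n : restr (ralg_map A) N).

Definition tact (x : tring) (y : tmod) : tmod :=
  tensor_lift (fun (b : ralg_mod B) (a : ralg_mod A) =>
    (tensor_lift (fun (m : restr (ralg_map B) M) (n : restr (ralg_map A) N) =>
      tmtens ((b : B) *: (m : M)) ((a : A) *: (n : N))) y : tmod)) x.

Lemma tact_balanced_in (b : B) (a : A) :
  balanced (fun (m : restr (ralg_map B) M) (n : restr (ralg_map A) N) =>
      tmtens (b *: (m : M)) (a *: (n : N))).
Proof.
split=> [m m' n|m n n'|r m n].
- by rewrite /tmtens scalerDr; apply: tensDl.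
- by rewrite /tmtens scalerDr; apply: tensDr.
- rewrite /tmtens !restr_scaleE !scalerA -!ralg_central -!scalerA.
  by rewrite -!restr_scaleE tensZ.
Qed.

Lemma tact_balanced_out (y : tmod) :
  balanced (fun (b : ralg_mod B) (a : ralg_mod A) =>
    (tensor_lift (fun (m : restr (ralg_map B) M) (n : restr (ralg_map A) N) =>
      tmtens ((b : B) *: (m : M)) ((a : A) *: (n : N))) y : tmod)).
Proof.
split=> [b b' a|b a a'|r b a].
- elim/tensor_ind: y => [|m n|x y Hx Hy].
  + by rewrite !(tensor_lift0 (tact_balanced_in _ _)) addr0.
  + rewrite !(tensor_lift_tens (tact_balanced_in _ _)) /tmtens scalerDl.
    exact: tensDl.
  + by rewrite !(tensor_liftD (tact_balanced_in _ _)) Hx Hy addrACA.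
- elim/tensor_ind: y => [|m n|x y Hx Hy].
  + by rewrite !(tensor_lift0 (tact_balanced_in _ _)) addr0.
  + rewrite !(tensor_lift_tens (tact_balanced_in _ _)) /tmtens scalerDl.
    exact: tensDr.
  + by rewrite !(tensor_liftD (tact_balanced_in _ _)) Hx Hy addrACA.
- elim/tensor_ind: y => [|m n|x y Hx Hy].
  + by rewrite !(tensor_lift0 (tact_balanced_in _ _)).
  + rewrite !(tensor_lift_tens (tact_balanced_in _ _)) /tmtens.
    rewrite !restr_scaleE /= -[ralg_map B r *: b]/(ralg_map B r * b).
    rewrite -[ralg_map A r *: a]/(ralg_map A r * a) -!scalerA.
    by rewrite -!restr_scaleE tensZ.
  + by rewrite !(tensor_liftD (tact_balanced_in _ _)) Hx Hy.
Qed.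

Lemma tactE (b : ralg_mod B) (a : ralg_mod A) (m : M) (n : N) :
  tact (tens b a) (tmtens m n) = tmtens ((b : B) *: m) ((a : A) *: n).
Proof.
rewrite /tact (tensor_lift_tens (tact_balanced_out _)).
by rewrite (tensor_lift_tens (tact_balanced_in _ _)).
Qed.

Lemma tactDl x x' y : tact (x + x') y = tact x y + tact x' y.
Proof. exact: (tensor_liftD (tact_balanced_out y)). Qed.

Lemma tact0l y : tact 0 y = 0.
Proof. exact: (tensor_lift0 (tact_balanced_out y)). Qed.

Lemma tact0r x : tact x 0 = 0.
Proof.
elim/tensor_ind: x => [|b a|x x' Hx Hx']; first exact: tact0l.
- rewrite /tact (tensor_lift_tens (tact_balanced_out _)).
  by rewrite (tensor_lift0 (tact_balanced_in _ _)).
- by rewrite tactDl Hx Hx' addr0.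
Qed.

Lemma tactDr x y y' : tact x (y + y') = tact x y + tact x y'.
Proof.
elim/tensor_ind: x => [|b a|x x' Hx Hx']; first by rewrite !tact0l addr0.
- rewrite /tact !(tensor_lift_tens (tact_balanced_out _)).
  by rewrite (tensor_liftD (tact_balanced_in _ _)).
- by rewrite !tactDl Hx Hx' addrACA.
Qed.

End Action.

Definition tmul (x y : tring) : tring := @tact B^o A^o x y.
Definition tone : tring := tens (1 : ralg_mod B) (1 : ralg_mod A).

Lemma tmulE (b b' : ralg_mod B) (a a' : ralg_mod A) :
  tmul (tens b a) (tens b' a') =
  tens ((b : B) * (b' : B) : ralg_mod B) ((a : A) * (a' : A) : ralg_mod A).
Proof. exact: (@tactE B^o A^o). Qed.

Section ActionAxioms.
Variables (M : lmodType B) (N : lmodType A).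

Lemma tactA x y (z : tmod M N) : tact x (tact y z) = tact (tmul x y) z.
Proof.
elim/tensor_ind: x => [|b a|x x' Hx Hx'].
- by rewrite /tmul !tact0l.
- elim/tensor_ind: y => [|b' a'|y y' Hy Hy'].
  + by rewrite /tmul !tact0r !tact0l !tact0r.
  + elim/tensor_ind: z => [|m n|z z' Hz Hz']; first by rewrite !tact0r.
    * by rewrite tmulE -[tens m n]/(tmtens m n) !tactE !scalerA.
    * by rewrite !tactDr Hz Hz'.
  + by rewrite /tmul tactDl !tactDr Hy Hy' tactDl.
- by rewrite /tmul !tactDl Hx Hx'.
Qed.

Lemma tact1 (z : tmod M N) : tact tone z = z.
Proof.
elim/tensor_ind: z => [|m n|z z' Hz Hz']; first by rewrite tact0r.
- by rewrite -[tens m n]/(tmtens m n) tactE !scale1r.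
- by rewrite tactDr Hz Hz'.
Qed.

End ActionAxioms.

Lemma tmulA : associative tmul.
Proof. by move=> x y z; apply: (@tactA B^o A^o). Qed.

Lemma tmul1 : left_id tone tmul.
Proof. by move=> x; apply: (@tact1 B^o A^o). Qed.

Lemma tmul1r : right_id tone tmul.
Proof.
move=> z; elim/tensor_ind: z => [|m n|z z' Hz Hz'].
- exact: (@tact0l B^o A^o).
- by rewrite tmulE !mulr1.
- by rewrite /tmul tactDl -!/(tmul _ _) Hz Hz'.
Qed.

Lemma tmulDl : left_distributive tmul +%R.
Proof. by move=> x y z; apply: (@tactDl B^o A^o). Qed.

Lemma tmulDr : right_distributive tmul +%R.
Proof. by move=> x y z; apply: (@tactDr B^o A^o). Qed.

HB.instance Definition _ := GRing.Zmodule_isPzRing.Build tring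
  tmulA tmul1 tmul1r tmulDl tmulDr.

Section ActionModule.
Variables (M : lmodType B) (N : lmodType A).

Lemma tact_morph (v : tmod M N) : {morph (@tact M N)^~ v : a b / a + b}.
Proof. by move=> x y; apply: tactDl. Qed.

HB.instance Definition _ := GRing.Zmodule_isLmodule.Build tring (tmod M N)
  (@tactA M N) (@tact1 M N) (@tactDr M N) tact_morph.

End ActionModule.

End TensorAction.

Section ExtensionOfScalars.
Variables (R S : comPzRingType) (f : {rmorphism R -> S}).

Lemma ralg_of_central (r : R) (s : S) : f r * s = s * f r.
Proof. exact: mulrC. Qed.

(* S seen as an R-algebra through f *)
Definition ralg_of : ralg R := RAlg ralg_of_central.

Variable A : ralg R.

Definition ext_ring : pzRingType := tring ralg_of A.

Definition ext_tens (s : S) (a : A) : ext_ring :=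
  tens (s : ralg_mod ralg_of) (a : ralg_mod A).

Definition ext_map (s : S) : ext_ring := ext_tens s 1.

Lemma ext_tensM s a s' a' :
  ext_tens s a * ext_tens s' a' = ext_tens (s * s') (a * a').
Proof. exact: tmulE. Qed.

Lemma ext_map_zmod : zmod_morphism ext_map.
Proof.
move=> x y; apply: (addIr (ext_map y)); rewrite subrK.
by rewrite /ext_map /ext_tens -[LHS]tensDl subrK.
Qed.

Lemma ext_map_monoid : monoid_morphism ext_map.
Proof. by split=> // x y; rewrite /ext_map ext_tensM mulr1. Qed.

HB.instance Definition _ :=
  GRing.isZmodMorphism.Build S ext_ring ext_map ext_map_zmod.
HB.instance Definition _ :=
  GRing.isMonoidMorphism.Build S ext_ring ext_map ext_map_monoid.

Lemma ext_map_central (s : S) (x : ext_ring) : ext_map s * x = x * ext_map s.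
Proof.
elim/tensor_ind: x => [|b a|x y Hx Hy]; first by rewrite mulr0 mul0r.
- by rewrite -[tens b a]/(ext_tens b a) !ext_tensM mulr1 mul1r mulrC.
- by rewrite mulrDr mulrDl Hx Hy.
Qed.

Definition ext : ralg S := RAlg ext_map_central.

End ExtensionOfScalars.

Section Localization.
Variables (R : idomainType) (p : prime_idealr R).

Definition loc_pred : {pred {fraction R}} :=
  fun x => `[< exists r s : R, s \notin p /\ x = tofrac r / tofrac s >].

Lemma loc_predP x :
  reflect (exists r s : R, s \notin p /\ x = tofrac r / tofrac s)
          (x \in loc_pred).
Proof. exact: asboolP. Qed.

Lemma notin_prime_neq0 (s : R) : s \notin p -> tofrac s != 0.
Proof.
by apply: contra; rewrite tofrac_eq0 => /eqP ->; apply: rpred0.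
Qed.

Lemma notin_primeM (s t : R) : s \notin p -> t \notin p -> s * t \notin p.
Proof. by rewrite prime_idealrM negb_or => -> ->. Qed.

Lemma loc_pred_tofrac (r : R) : tofrac r \in loc_pred.
Proof.
by apply/loc_predP; exists r, 1; rewrite idealr1 tofrac1 divr1.
Qed.

Lemma loc_pred_subring : subring_closed loc_pred.
Proof.
split=> [|x y|x y]; first by rewrite -tofrac1 loc_pred_tofrac.
- move=> /loc_predP [r [s [ps ->]]] /loc_predP [r' [s' [ps' ->]]].
  apply/loc_predP; exists (r * s' - r' * s), (s * s').
  split; first exact: notin_primeM.
  by rewrite tofracB !tofracM -mulNr addf_div ?notin_prime_neq0 // mulNr.
- move=> /loc_predP [r [s [ps ->]]] /loc_predP [r' [s' [ps' ->]]].
  apply/loc_predP; exists (r * r'), (s * s').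
  split; first exact: notin_primeM.
  by rewrite !tofracM mulf_div.
Qed.

HB.instance Definition _ := GRing.isSubringClosed.Build {fraction R} loc_pred
  loc_pred_subring.

Record loc := Loc { loc_val : {fraction R}; loc_valP : loc_val \in loc_pred }.

HB.instance Definition _ := [isSub for loc_val].
HB.instance Definition _ := [Choice of loc by <:].
HB.instance Definition _ := [SubChoice_isSubComNzRing of loc by <:].

Definition to_loc (r : R) : loc := Loc (loc_pred_tofrac r).

Lemma to_loc_zmod : zmod_morphism to_loc.
Proof. by move=> x y; apply: val_inj; rewrite /= tofracB. Qed.

Lemma to_loc_monoid : monoid_morphism to_loc.
Proof. by split=> [|x y]; apply: val_inj; rewrite /= ?tofrac1 ?tofracM. Qed.

HB.instance Definition _ :=
  GRing.isZmodMorphism.Build R loc to_loc to_loc_zmod.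
HB.instance Definition _ :=
  GRing.isMonoidMorphism.Build R loc to_loc to_loc_monoid.

End Localization.

Section Center.
Variable A : pzRingType.

Definition central : {pred A} := fun x => `[< forall y, x * y = y * x >].

Lemma centralP (x : A) : reflect (forall y, x * y = y * x) (x \in central).
Proof. exact: asboolP. Qed.

Lemma central_subring : subring_closed central.
Proof.
split=> [|x y /centralP Hx /centralP Hy|x y /centralP Hx /centralP Hy];
  apply/centralP => z.
- by rewrite mul1r mulr1.
- by rewrite mulrBl mulrBr Hx Hy.
- by rewrite -mulrA Hy mulrA Hx mulrA.
Qed.

HB.instance Definition _ := GRing.isSubringClosed.Build A central
  central_subring.

Record center := Center { center_val :> A; center_valP : center_val \in central }.

HB.instance Definition _ := [isSub for center_val].
HB.instance Definition _ := [Choice of center by <:].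
HB.instance Definition _ := GRing.SubChoice_isSubPzRing.Build A central center
  (GRing.subringClosedP central).

Lemma center_mulC : @commutative center center *%R.
Proof. by move=> x y; apply: val_inj; apply/centralP; apply: valP. Qed.

HB.instance Definition _ :=
  GRing.PzRing_hasCommutativeMul.Build center center_mulC.

End Center.

Lemma ralg_map_central (R : comPzRingType) (A : ralg R) (r : R) :
  ralg_map A r \in @central A.
Proof. by apply/centralP => y; apply: ralg_central. Qed.

Definition to_center (R : comPzRingType) (A : ralg R) (r : R) : center A :=
  Center (ralg_map_central A r).

Definition noetherian (R : comPzRingType) : Prop :=
  forall I : {pred R^o}, submod_closed I ->
  exists s : seq R, forall x : R,
    x \in I <-> exists c : 'I_(size s) -> R, x = \sum_i c i * s`_i.

Definition normal_domain (R : idomainType) : Prop :=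
  forall x : {fraction R}, integralOver (@tofrac R) x ->
  exists r : R, x = tofrac r.

Definition fin_gen (R : comPzRingType) (M : lmodType R) : Prop :=
  exists s : seq M, forall x : M,
  exists c : 'I_(size s) -> R, x = \sum_i c i *: s`_i.

Definition flat (R : comPzRingType) (M : lmodType R) : Prop :=
  forall (N N' : lmodType R) (f : {linear N -> N'}), injective f ->
  injective (tensor_map f (@id M)).

Definition simple_module (B : pzRingType) (V : lmodType B) : Prop :=
  (exists v : V, v != 0) /\
  forall W : {pred V}, submod_closed W ->
    (forall v, v \in W -> v = 0) \/ (forall v, v \in W).

Definition split_algebra (k : fieldType) (B : ralg k) : Prop :=
  forall V : lmodType B, simple_module V ->
  forall (L : fieldType) (f : {rmorphism k -> L}),
    simple_module (tmod (B := ralg_of f) (A := B) L^o V : lmodType (ext f B)).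

Definition central_idempotent (B : pzRingType) (e : B) : Prop :=
  e \in @central B /\ e * e = e.

Definition block_idempotent (B : pzRingType) (c : B) : Prop :=
  [/\ central_idempotent c, c != 0 &
      forall e f : B, central_idempotent e -> central_idempotent f ->
        e * f = 0 -> c = e + f -> e = 0 \/ f = 0].

Definition belongs_to (B : pzRingType) (c : B) (V : lmodType B) : Prop :=
  forall v : V, exists w : V, v = c *: w.

(* [prime_idealr] of the library is not available for possibly zero rings. *)
Definition prime_ideal (Z : comPzRingType) (Q : {pred Z}) : Prop :=
  [/\ submod_closed (Q : {pred Z^o}), 1 \notin Q &
      forall u v, u * v \in Q -> u \in Q \/ v \in Q].

Section Families.
Variables (R : idomainType) (A : ralg R).

Definition AK : ralg {fraction R} := ext (@tofrac R) A.

Definition to_AK (a : A) : AK := ext_tens (@tofrac R) 1 a.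

Definition family_of (b : AK) (S : lmodType AK) : Prop :=
  simple_module S /\ belongs_to b S.

Definition is_family (F : lmodType AK -> Prop) : Prop :=
  exists2 b : AK, block_idempotent b & forall S, F S <-> family_of b S.

Section AtPrime.
Variable p : prime_idealr R.

Definition Aloc : ralg (loc p) := ext (@to_loc R p) A.

Definition to_Aloc (a : A) : Aloc := ext_tens (@to_loc R p) 1 a.

Definition Aloc_AK : Aloc -> AK :=
  tensor_map (M := ralg_mod (ralg_of (@to_loc R p)))
             (M' := ralg_mod (ralg_of (@tofrac R)))
             (fun x : loc p => loc_val x) (@id (ralg_mod A)).

Definition pfamily_of (c : Aloc) : lmodType AK -> Prop :=
  family_of (Aloc_AK c).

Definition is_pfamily (F : lmodType AK -> Prop) : Prop :=
  exists2 c : Aloc, block_idempotent c & forall S, F S <-> pfamily_of c S.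

Definition same_pfamily (S T : lmodType AK) : Prop :=
  exists F, [/\ is_pfamily F, F S & F T].

Definition lies_over (Q : {pred center A}) : Prop :=
  forall r : R, (to_center A r \in Q) = (r \in p).

(* The ideal of the center of Aloc generated by the image of Q. *)
Definition ext_ideal (Q : {pred center A}) (x : Aloc) : Prop :=
  exists (n : nat) (w : 'I_n -> center Aloc) (q : 'I_n -> center A),
    (forall i, q i \in Q) /\
    x = \sum_i center_val (w i) * to_Aloc (center_val (q i)).

(* The graph of the canonical bijection between the p-families and the fibre  *)
(* over p.                                                                     *)
Definition pfamily_prime (F : lmodType AK -> Prop) (Q : {pred center A}) :
    Prop :=
  exists c : Aloc,
    [/\ block_idempotent c, forall S, F S <-> pfamily_of c S,
        prime_ideal Q, lies_over Q & ext_ideal Q (1 - c)].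

End AtPrime.

Section CentralCharacter.
Variable S : lmodType AK.

(* The default value 0 of [xget] is irrelevant when AK is split: the center    *)
(* then acts by scalars; likewise below, R being normal.                       *)
Definition Omega (z : center AK) : {fraction R} :=
  xget 0 [set k | forall v : S, center_val z *: v = ralg_map AK k *: v]%classic.

Lemma to_AK_central (z : center A) : to_AK (center_val z) \in @central AK.
Proof.
apply/centralP => x; elim/tensor_ind: x => [|b a|x y Hx Hy].
- by rewrite mulr0 mul0r.
- rewrite -[tens b a]/(ext_tens (@tofrac R) b a) !ext_tensM mulr1 mul1r.
  by have /centralP -> := center_valP z.
- by rewrite mulrDr mulrDl Hx Hy.
Qed.

Definition Omega' (z : center A) : R :=
  xget 0 [set r | tofrac r = Omega (Center (to_AK_central z))]%classic.

Definition Omegap (p : prime_idealr R) (z : center A) : {ideal_quot p} :=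
  \pi_({ideal_quot p}) (Omega' z).

Definition ker_Omegap (p : prime_idealr R) : {pred center A} :=
  fun z => Omegap p z == 0.

End CentralCharacter.

Definition Omega_fam (F : lmodType AK -> Prop) (z : center A) : R :=
  xget 0 [set r | exists2 S, F S & r = Omega' S z]%classic.

Definition gluing_locus (F F' : lmodType AK -> Prop) : set (prime_idealr R) :=
  [set p | exists G, [/\ is_pfamily p G, forall S, F S -> G S &
                         forall S, F' S -> G S]]%classic.

Definition alg_generates (n : nat) (z : 'I_n -> center A) : Prop :=
  forall W : {pred center A}, subring_closed W ->
    (forall r, to_center A r \in W) -> (forall i, z i \in W) ->
    forall x, x \in W.

End Families.

Definition zero_locus (R : idomainType) (X : set R) : set (prime_idealr R) :=
  [set p | forall x, X x -> x \in (p : prime_idealr R)]%classic.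

(* Main.v *)
(* By Schur's lemma and splitness a central element of A^K acts on a simple
   module S by a scalar; for an element of Z this scalar is an eigenvalue of a
   matrix over R, hence lies in R by normality. There are finitely many central
   characters, and an element of Z killed by all of them is nilpotent. Given p
   and S, characters not congruent modulo p are separated by elements of Z up to
   factors outside p, so suitable products yield f in Z(A_p) acting as 1 on the
   T congruent to S and as 0 on the others; f(1 - f) is then nilpotent and f
   lifts to an idempotent g_S. A central idempotent of A_p takes the same value
   0 or 1 on congruent modules, so g_S is a block idempotent, and all block
   idempotents of A_p are of this form: the p-families are the congruence
   classes modulo p. Finally a prime Q of Z over p contains the kernel of some
   character, since their product is nil, and this forces Q = Ker Omega_S^p. *)

Require Import Defs.
From HB Require Import structures.
From mathcomp Require Import all_boot all_order all_algebra.
From mathcomp Require Import boolp classical_sets.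

Set Implicit Arguments.
Unset Strict Implicit.
Unset Printing Implicit Defensive.

Import GRing.Theory.

Local Open Scope ring_scope.
Local Open Scope quotient_scope.

(** * Maximal submodules and simple quotients *)

Section Submodules.
Variables (B : pzRingType) (V : lmodType B).
Implicit Types W : {pred V}.

Lemma submod0 W : submod_closed W -> 0 \in W.
Proof. by case. Qed.

Lemma submodD W u v : submod_closed W -> u \in W -> v \in W -> u + v \in W.
Proof. by move=> [_ Wl] Wu Wv; rewrite -[u]scale1r Wl. Qed.

Lemma submodZ W b v : submod_closed W -> v \in W -> b *: v \in W.
Proof. by move=> [W0 Wl] Wv; rewrite -[_ *: _]addr0 Wl. Qed.

Lemma submodB W u v : submod_closed W -> u \in W -> v \in W -> u - v \in W.
Proof.
by move=> Ws Wu Wv; rewrite -scaleN1r addrC; case: Ws => _; apply.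
Qed.

(* Zorn is applied to the sets [X] such that the union of [W] and [X] is a
   submodule avoiding [v], so that the empty chain needs no special case. *)
Lemma maximal_submod W v : submod_closed W -> v \notin W ->
  exists M : {pred V}, [/\ submod_closed M, {subset W <= M}, v \notin M &
    forall N : {pred V}, submod_closed N -> {subset M <= N} -> v \notin N ->
      {subset N <= M}].
Proof.
move=> Ws Wv; pose ext (X : set V) : {pred V} := fun u => `[< u \in W \/ X u >].
have [F FP Ftot|X [[Xs Xv] Xmax]] :=
    @Zorn_bigcup V [set X | submod_closed (ext X) /\ v \notin ext X]%classic.
  split=> [|]; last first.
    apply/asboolPn => -[|[X FX Xv]]; first exact/negP.
    by have [_ /asboolPn] := FP _ FX; apply; right.
  split=> [|b x y]; first by apply/asboolP; left; apply: submod0.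
  have mono X Y : (X `<=` Y)%classic -> {subset ext X <= ext Y}.
    move=> XY u /asboolP[Wu|Xu]; apply/asboolP; [by left|right; exact: XY].
  have inF X u : F X -> u \in ext X -> u \in ext (\bigcup_(X in F) X)%classic.
    by move=> FX; apply: mono => t Xt; exists X.
  move=> /asboolP[Wx|[X FX Xx]] /asboolP[Wy|[Y FY Yy]].
  - by apply/asboolP; left; case: Ws => _; apply.
  - apply: (inF Y) => //; case: (FP _ FY) => -[_ Yl] _.
    by apply: Yl; apply/asboolP; [left|right].
  - apply: (inF X) => //; case: (FP _ FX) => -[_ Yl] _.
    by apply: Yl; apply/asboolP; [right|left].
  - have [XY|YX] := Ftot _ _ FX FY.
    + apply: (inF Y) => //; case: (FP _ FY) => -[_ Yl] _.
      by apply: Yl; apply/asboolP; right => //; apply: XY.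
    + apply: (inF X) => //; case: (FP _ FX) => -[_ Yl] _.
      by apply: Yl; apply/asboolP; right => //; apply: YX.
exists (ext X); split=> // [u Wu|N Ns XN Nv u Nu]; first by apply/asboolP; left.
apply/negP => /negP Xu.
have extN : ext [set u | u \in N]%classic = N.
  apply/funext => t; apply/asboolP/idP => [[Wt|//]|]; last by right.
  by apply: XN; apply/asboolP; left.
apply: (Xmax [set u | u \in N]%classic); last by rewrite /= extN.
split=> [t Xt|NX]; first by apply: XN; apply/asboolP; right.
by case/asboolPn: Xu; right; apply: NX.
Qed.

End Submodules.

(** * Quotient modules *)

Section QuotientModule.
Variables (B : pzRingType) (V : lmodType B) (W : {pred V}).
Hypothesis Ws : submod_closed W.

(** The identity on [W], indexed by the closure proof: it gives a head symbol to which the submodule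
    structure can be attached. *)
Definition submod_pred of submod_closed W : {pred V} := W.
HB.instance Definition _ := GRing.isSubmodClosed.Build B V (submod_pred Ws) Ws.

Definition quot_mod : Type := Quotient.quot (submod_pred Ws).
HB.instance Definition _ := GRing.Zmodule.on quot_mod.

Definition quot_proj (v : V) : quot_mod :=
  \pi_(Quotient.quot (submod_pred Ws)) v.

Lemma quot_projD u v : quot_proj (u + v) = quot_proj u + quot_proj v.
Proof. by rewrite /quot_proj raddfD. Qed.

Lemma quot_proj_eq u v : (quot_proj u = quot_proj v) <-> (u - v \in W).
Proof.
rewrite -[u - v \in W]/(u - v \in submod_pred Ws) Quotient.idealrBE.
by split=> [/eqP|/eqP].
Qed.

Lemma quot_proj_eq0 v : (quot_proj v = 0) <-> (v \in W).
Proof.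
have p0 : quot_proj 0 = 0 by rewrite /quot_proj raddf0.
by rewrite -[v in v \in W]subr0 -p0; apply: quot_proj_eq.
Qed.

Lemma quot_projK x : quot_proj (repr x) = x.
Proof. exact: reprK. Qed.

Definition quot_scale (b : B) (x : quot_mod) : quot_mod :=
  quot_proj (b *: repr x).

Lemma quot_scaleE b v : quot_scale b (quot_proj v) = quot_proj (b *: v).
Proof.
apply/quot_proj_eq; rewrite -scalerBr; apply: submodZ => //.
by apply/quot_proj_eq; rewrite quot_projK.
Qed.

Lemma quot_scaleA a b x : quot_scale a (quot_scale b x) = quot_scale (a * b) x.
Proof. by rewrite -[x]quot_projK !quot_scaleE scalerA. Qed.
Lemma quot_scale1 : left_id 1 quot_scale.
Proof. by move=> x; rewrite -[x]quot_projK quot_scaleE scale1r. Qed.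
Lemma quot_scaleDr : right_distributive quot_scale +%R.
Proof.
move=> a x y; rewrite -[x]quot_projK -[y]quot_projK -quot_projD !quot_scaleE.
by rewrite scalerDr quot_projD.
Qed.
Lemma quot_scaleDl x : {morph quot_scale^~ x : a b / a + b}.
Proof.
move=> a b /=; rewrite -[x]quot_projK !quot_scaleE -quot_projD.
by rewrite scalerDl.
Qed.

HB.instance Definition _ := GRing.Zmodule_isLmodule.Build B quot_mod
  quot_scaleA quot_scale1 quot_scaleDr quot_scaleDl.

Lemma quot_projZ b v : quot_proj (b *: v) = b *: quot_proj v.
Proof. exact/esym/quot_scaleE. Qed.

End QuotientModule.

(** The left ideal [B x] misses 1, so it lies in a maximal left ideal [M]; in the simple module
    [B / M] the class of 1 is nonzero and killed by [x]. This is the source of the simple modules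
    produced below. *)
Lemma exists_simple_killed (B : pzRingType) (x : B) :
  (forall y, y * x <> 1) ->
  exists (V : lmodType B) (v : V), [/\ simple_module V, v != 0 & x *: v = 0].
Proof.
move=> xNu; pose W : {pred B^o} := fun u => `[< exists y, u = y * x >].
have Ws : submod_closed W.
  split=> [|b u v /asboolP[y ->] /asboolP[z ->]]; apply/asboolP.
    by exists 0; rewrite mul0r.
  by exists (b * y + z); rewrite mulrDl -mulrA.
have W1 : (1 : B^o) \notin W.
  by apply/asboolPn => -[y /esym]; apply: xNu.
have [M [Ms WM M1 Mmax]] := maximal_submod Ws W1.
exists (quot_mod Ms), (quot_proj Ms 1).
have q0 := quot_proj_eq0 Ms.
have v0 : quot_proj Ms 1 != 0 by apply/eqP => /q0; apply/negP.
split=> //; last first.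
  rewrite -quot_projZ; apply/q0/WM/asboolP.
  by exists 1; rewrite mul1r; apply: mulr1.
split; first by exists (quot_proj Ms 1).
move=> X Xs; pose N : {pred B^o} := fun u => quot_proj Ms u \in X.
have Ns : submod_closed N.
  split=> [|b u v Nu Nv]; rewrite unfold_in.
    by rewrite (_ : quot_proj _ _ = 0) ?submod0 //; apply/q0/submod0.
  by rewrite quot_projD quot_projZ; case: Xs => _; apply.
have MN : {subset M <= N}.
  by move=> u /q0 u0; rewrite unfold_in u0; apply: submod0.
have [N1|N1] := boolP ((1 : B^o) \in N); [right|left] => v.
  have -> : v = (repr v : B) *: quot_proj Ms 1; last exact: submodZ.
  by rewrite -quot_projZ -[_ *: _]/((repr v : B) * 1) mulr1 quot_projK.
by move=> Xv; rewrite -[v]quot_projK; apply/q0/(Mmax N) => //;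
   rewrite unfold_in quot_projK.
Qed.

(** * Schur's lemma for split algebras *)

Section EndomorphismRing.
Variables (B : pzRingType) (V : lmodType B).

Record lend := LEnd {
  lend_fun :> V -> V;
  lendD : forall u v, lend_fun (u + v) = lend_fun u + lend_fun v;
  lendZ : forall b v, lend_fun (b *: v) = b *: lend_fun v }.

HB.instance Definition _ := gen_eqMixin lend.
HB.instance Definition _ := gen_choiceMixin lend.

Lemma lendP (f g : lend) : (forall v, f v = g v) -> f = g.
Proof.
case: f g => f fD fZ [g gD gZ] /= /funext fg; case: g / fg in gD gZ *.
by congr LEnd; apply: Prop_irrelevance.
Qed.

Lemma lend0 (f : lend) : f 0 = 0.
Proof. by apply: (addrI (f 0)); rewrite -lendD !addr0. Qed.

Program Definition lend_zero := @LEnd (fun=> 0) _ _.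
Next Obligation. by rewrite addr0. Qed.
Next Obligation. by rewrite scaler0. Qed.

Program Definition lend_opp (f : lend) := @LEnd (fun v => - f v) _ _.
Next Obligation. by rewrite lendD opprD. Qed.
Next Obligation. by rewrite lendZ scalerN. Qed.

Program Definition lend_add (f g : lend) := @LEnd (fun v => f v + g v) _ _.
Next Obligation. by rewrite !lendD addrACA. Qed.
Next Obligation. by rewrite !lendZ scalerDr. Qed.

Program Definition lend_one := @LEnd id _ _.

Program Definition lend_mul (f g : lend) := @LEnd (fun v => f (g v)) _ _.
Next Obligation. by rewrite !lendD. Qed.
Next Obligation. by rewrite !lendZ. Qed.

Lemma lend_addA : associative lend_add.
Proof. by move=> f g h; apply: lendP => v; apply: addrA. Qed.
Lemma lend_addC : commutative lend_add.
Proof. by move=> f g; apply: lendP => v; apply: addrC. Qed.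
Lemma lend_add0 : left_id lend_zero lend_add.
Proof. by move=> f; apply: lendP => v; apply: add0r. Qed.
Lemma lend_addN : left_inverse lend_zero lend_opp lend_add.
Proof. by move=> f; apply: lendP => v; apply: addNr. Qed.

HB.instance Definition _ := GRing.isZmodule.Build lend
  lend_addA lend_addC lend_add0 lend_addN.

Lemma lend_mulA : associative lend_mul.
Proof. by move=> f g h; apply: lendP. Qed.
Lemma lend_mul1 : left_id lend_one lend_mul.
Proof. by move=> f; apply: lendP. Qed.
Lemma lend_mul1r : right_id lend_one lend_mul.
Proof. by move=> f; apply: lendP. Qed.
Lemma lend_mulDl : left_distributive lend_mul +%R.
Proof. by move=> f g h; apply: lendP. Qed.
Lemma lend_mulDr : right_distributive lend_mul +%R.
Proof. by move=> f g h; apply: lendP => v; apply: lendD. Qed.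

HB.instance Definition _ := GRing.Zmodule_isPzRing.Build lend
  lend_mulA lend_mul1 lend_mul1r lend_mulDl lend_mulDr.

Lemma simple_lend_inj (f : lend) : simple_module V -> f <> 0 ->
  forall v, f v = 0 -> v = 0.
Proof.
move=> [_ Vs] f0; have [|fK v fv0|fK] := Vs (fun v => f v == 0).
- split=> [|b u v /eqP fu /eqP fv]; apply/eqP; rewrite ?lend0 //.
  by rewrite lendD lendZ fu fv scaler0 addr0.
- by apply: fK; apply/eqP.
- by case: f0; apply: lendP => v; apply/eqP/fK.
Qed.

Lemma simple_lend_surj (f : lend) : simple_module V -> f <> 0 ->
  forall v, exists u, f u = v.
Proof.
move=> [_ Vs] f0; pose I : {pred V} := fun v => `[< exists u, f u = v >].
have [|fI|fI v] := Vs I.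
- split=> [|b _ _ /asboolP[u <-] /asboolP[v <-]]; apply/asboolP.
    by exists 0; apply: lend0.
  by exists (b *: u + v); rewrite lendD lendZ.
- by case: f0; apply: lendP => v; apply: fI; apply/asboolP; exists v.
- exact/asboolP/fI.
Qed.

Lemma simple_lend_inv (f : lend) : simple_module V -> f <> 0 ->
  exists g : lend, f * g = 1 /\ g * f = 1.
Proof.
move=> Vs f0; have finj u v : f u = f v -> u = v.
  move=> fuv; apply/eqP; rewrite -subr_eq0; apply/eqP.
  apply: (simple_lend_inj Vs f0); rewrite -scaleN1r lendD lendZ scaleN1r fuv.
  exact: subrr.
have /choice[g fg] := simple_lend_surj Vs f0.
have gD u v : g (u + v) = g u + g v by apply: finj; rewrite lendD !fg.
have gZ b v : g (b *: v) = b *: g v by apply: finj; rewrite lendZ !fg.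
by exists (LEnd gD gZ); split; apply: lendP => v //=; apply: finj.
Qed.

End EndomorphismRing.

Section SchurField.
Variables (B : pzRingType) (V : lmodType B) (Vs : simple_module V).

(* The centre of End V is a field by Schur's lemma; unlike the image of Z(B), no
   finiteness is needed for the inverses. *)
Definition schur_field of simple_module V : Type := center (lend V).
Local Notation L := (schur_field Vs).

HB.instance Definition _ := GRing.ComPzRing.on L.

Lemma schur_oner_neq0 : 1 != 0 :> L.
Proof.
have [[v v0] _] := Vs; apply/eqP.
by move=> /(congr1 (fun z : L => center_val z v)) /= v1; case/eqP: v0.
Qed.

HB.instance Definition _ := GRing.PzSemiRing_isNonZero.Build L schur_oner_neq0.

Lemma schur_inv_subproof (z : L) :
  exists y : L, (z != 0 -> y * z = 1) /\ (z = 0 -> y = 0).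
Proof.
have [->|z0] := eqVneq z 0; first by exists 0.
have [|g [zg gz]] := @simple_lend_inv _ _ (center_val z) Vs.
  by move=> z1; case/eqP: z0; apply: val_inj.
have gC : g \in @central (lend V).
  apply/centralP => f; rewrite -[LHS]mulr1 -zg.
  have /centralP zC := center_valP z.
  by rewrite !mulrA -(mulrA g f) -zC !mulrA gz mul1r.
exists (Center gC); split=> [_|z1]; first exact: val_inj.
by rewrite z1 eqxx in z0.
Qed.

Definition schur_inv (z : L) : L := projT1 (cid (schur_inv_subproof z)).

Lemma schur_mulVf (z : L) : z != 0 -> schur_inv z * z = 1.
Proof. by rewrite /schur_inv; case: cid => y []. Qed.

Lemma schur_inv0 : schur_inv 0 = 0.
Proof. by rewrite /schur_inv; case: cid => y [? /=]; apply. Qed.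

HB.instance Definition _ :=
  GRing.ComNzRing_isField.Build L schur_mulVf schur_inv0.

End SchurField.

(** A submodule [M] maximal among those avoiding [u] is a complement of the line through [u];
    [phi x] is the only [c] with [x - c *: u] in [M]. *)
Lemma exists_functional (k : fieldType) (U : lmodType k) (u : U) : u != 0 ->
  exists phi : U -> k, [/\ forall x y, phi (x + y) = phi x + phi y,
    forall c x, phi (c *: x) = c * phi x & phi u = 1].
Proof.
move=> u0; have Ws : submod_closed (pred1 (0 : U)).
  by split=> [|c x y /eqP -> /eqP ->]; rewrite inE // scaler0 addr0.
have [M [Ms _ Mu Mmax]] := @maximal_submod _ _ (pred1 0) u Ws u0.
have ex x : exists c, x - c *: u \in M.
  have [Mx|Mx] := boolP (x \in M); first by exists 0; rewrite scale0r subr0.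
  (* [N] is [M] plus the line through [x]; it is strictly larger than [M], so by maximality it
     contains [u]. *)
  pose N : {pred U} := fun y => `[< exists c, y - c *: x \in M >].
  have Ns : submod_closed N.
    split=> [|c y z /asboolP[a Ma] /asboolP[b Mb]]; apply/asboolP.
      by exists 0; rewrite scale0r subr0 submod0.
    exists (c * a + b); rewrite scalerDl -scalerA opprD addrACA -scalerBr.
    by apply: submodD => //; apply: submodZ.
  have MN : {subset M <= N}.
    by move=> y My; apply/asboolP; exists 0; rewrite scale0r subr0.
  have [/asboolP[c Mc]|Nu] := boolP (u \in N); last first.
    case/negP: Mx; apply: (Mmax N Ns MN Nu).
    by apply/asboolP; exists 1; rewrite scale1r subrr submod0.
  have c0 : c != 0.
    by apply: contraNneq Mu => c0; rewrite c0 scale0r subr0 in Mc.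
  exists c^-1; rewrite (_ : x - _ = - c^-1 *: (u - c *: x)).
    exact: submodZ.
  by rewrite scalerBr !scaleNr scalerA mulVf // scale1r opprK addrC.
have uniq x c d : x - c *: u \in M -> x - d *: u \in M -> c = d.
  move=> Mc Md; apply/eqP; rewrite -subr_eq0; apply: contraNT Mu => cd.
  rewrite -[u]scale1r -(mulVf cd) -scalerA; apply: submodZ => //.
  have -> : (c - d) *: u = (x - d *: u) - (x - c *: u); last exact: submodB.
  by rewrite opprB [RHS]addrC addrA subrK scalerBl.
have /choice[phi phiP] := ex.
exists phi; split=> [x y|c x|].
- apply: uniq (phiP _) _; rewrite scalerDl opprD addrACA; exact: submodD.
- apply: uniq (phiP _) _; rewrite -scalerA -scalerBr; exact: submodZ.
- by apply: uniq (phiP _) _; rewrite scale1r subrr submod0.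
Qed.

(** * Scalar action of central elements *)

Section SplitSchur.
Variables (k : fieldType) (B : ralg k) (V : lmodType B).
Hypothesis Vs : simple_module V.
Local Notation L := (schur_field Vs).

Section Scaling.
Variables (x : B) (xC : x \in @central B).

Definition scaling_lend : lend V.
Proof.
refine (@LEnd B V (fun v => x *: v) _ _).
  exact: scalerDr.
by move=> b v; rewrite !scalerA; have /centralP -> := xC.
Defined.

Lemma scaling_lend_central : scaling_lend \in @central (lend V).
Proof. by apply/centralP => f; apply: lendP => v /=; rewrite lendZ. Qed.

Definition scaling : L := Center scaling_lend_central.

End Scaling.

Definition schur_map (c : k) : L := scaling (ralg_map_central B c).

Lemma schur_map_zmod : zmod_morphism schur_map.
Proof.
move=> c d; apply: val_inj; apply: lendP => v /=.
by rewrite rmorphB scalerBl.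
Qed.

Lemma schur_map_monoid : monoid_morphism schur_map.
Proof.
split=> [|c d]; apply: val_inj; apply: lendP => v /=.
  by rewrite rmorph1 scale1r.
by rewrite rmorphM scalerA.
Qed.

HB.instance Definition _ :=
  GRing.isZmodMorphism.Build k L schur_map schur_map_zmod.
HB.instance Definition _ :=
  GRing.isMonoidMorphism.Build k L schur_map schur_map_monoid.

Local Notation ext_mod :=
  (tmod (B := ralg_of schur_map) (A := B) L^o V : lmodType (ext schur_map B)).

Definition schur_eval : ext_mod -> V :=
  tensor_lift (M := restr (ralg_map (ralg_of schur_map)) L^o)
              (N := restr (ralg_map B) V)
    (fun l v => (center_val (l : L)) v).

Lemma schur_eval_balanced :
  balanced (M := restr (ralg_map (ralg_of schur_map)) L^o)
           (N := restr (ralg_map B) V)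
    (fun l v => (center_val (l : L)) v : V).
Proof.
split=> [//|l v w|c l v]; first exact: (lendD (center_val (l : L))).
by rewrite !restr_scaleE lendZ.
Qed.

(** After evaluation, the action of the pure tensor of [l] and [b] becomes [v |-> l (b *: v)], so
    the kernel of [schur_eval] is stable under the extended algebra. *)
Lemma schur_eval_act x y :
  (schur_eval y = 0) -> schur_eval (x *: y) = 0.
Proof.
have evD := tensor_liftD schur_eval_balanced.
have ev0 := tensor_lift0 schur_eval_balanced.
rewrite -[x *: y]/(tact x y).
elim/tensor_ind: x => [_|l b|x x' Hx Hx' y0].
- by rewrite tact0l; apply: ev0.
- suff -> : schur_eval (tact (tens l b) y) =
      center_val (l : L) ((b : B) *: schur_eval y).
    by move=> ->; rewrite scaler0 lend0.
  elim/tensor_ind: y => [|m v|y y' Hy Hy'].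
  + by rewrite tact0r /schur_eval !ev0 scaler0 lend0.
  + rewrite -[tens m v]/(@tmtens _ (ralg_of schur_map) B L^o V m v) tactE.
    rewrite /schur_eval /tmtens.
    by rewrite !(tensor_lift_tens schur_eval_balanced) /= lendZ.
  + by rewrite tactDr /schur_eval !evD -!/(schur_eval _) Hy Hy' scalerDr lendD.
- by rewrite tactDl /schur_eval evD -!/(schur_eval _) Hx // Hx' // addr0.
Qed.

Hypothesis splitB : split_algebra B.

(** Splitness makes the scalar extension of [V] to [L] simple; the kernel is a proper submodule,
    since the tensor of 1 and [v] evaluates to [v], hence it is zero. *)
Lemma schur_eval_inj y : schur_eval y = 0 -> y = 0.
Proof.
have evD := tensor_liftD schur_eval_balanced.
have [_ extS] := splitB Vs schur_map.
have [|K0 y0|K1] := extS (fun y => schur_eval y == 0).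
- split=> [|a u v /eqP u0 /eqP v0]; apply/eqP.
    exact: (tensor_lift0 schur_eval_balanced).
  by rewrite /schur_eval evD -!/(schur_eval _) v0 schur_eval_act // addr0.
- by apply: K0; apply/eqP.
- have [[v v0] _] := Vs; case/eqP: v0.
  have /eqP <- := K1 (@tmtens _ (ralg_of schur_map) B L^o V 1 v).
  by rewrite /schur_eval (tensor_lift_tens schur_eval_balanced).
Qed.

(* Evaluation is injective on the scalar extension of V to L, so there x may be
   moved from V to L; a k-linear form on L mapping 1 to 1 turns it into a
   scalar. *)
Lemma split_central_scalar x : x \in @central B ->
  exists c : k, forall v : V, x *: v = ralg_map B c *: v.
Proof.
move=> xC; pose U := restr (ralg_map (ralg_of schur_map)) L^o.
have [|phi [phiD phiZ phi1]] := @exists_functional k U (1 : L).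
  exact: oner_neq0.
exists (phi (scaling xC)) => v.
have phib : balanced (M := U) (N := restr (ralg_map B) V)
    (fun l v => ralg_map B (phi l) *: (v : V)).
  split=> [l m w|l w w'|c l w]; rewrite ?phiD ?rmorphD ?scalerDl ?scalerDr //.
  by rewrite phiZ mulrC rmorphM -scalerA restr_scaleE.
have /(congr1 (tensor_lift (M := U)
    (N := restr (ralg_map B) V) (fun l v => ralg_map B (phi l) *: (v : V)))) :
    @tmtens _ (ralg_of schur_map) B L^o V 1 (x *: v) =
    @tmtens _ (ralg_of schur_map) B L^o V (scaling xC) v.
  apply/eqP; rewrite -subr_eq0; apply/eqP.
  apply: schur_eval_inj.
  have evD := tensor_liftD schur_eval_balanced.
  have evN a : schur_eval (- a) = - schur_eval a.
    apply: (addIr (schur_eval a)); rewrite -[LHS]evD !addNr.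
    exact: (tensor_lift0 schur_eval_balanced).
  rewrite [LHS]evD -!/(schur_eval _) evN /schur_eval.
  by rewrite !(tensor_lift_tens schur_eval_balanced) /= subrr.
by rewrite !(tensor_lift_tens phib) phi1 rmorph1 scale1r.
Qed.

End SplitSchur.

(** * Central idempotents and scalar extensions *)

Section CentralIdempotents.
Variable B : pzRingType.
Implicit Types (e f : B) (V : lmodType B).

Lemma central_idempotent_act e V : central_idempotent e -> simple_module V ->
  (forall v : V, e *: v = 0) \/ (forall v : V, e *: v = v).
Proof.
move=> [/centralP eC ee] [_ Vs].
have [|K0|K1] := Vs (fun v => e *: v == 0).
- split=> [|b u v /eqP u0 /eqP v0]; apply/eqP; rewrite ?scaler0 //.
  by rewrite scalerDr scalerA eC -scalerA u0 v0 scaler0 addr0.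
- right=> v; apply/eqP; rewrite eq_sym -subr_eq0; apply/eqP/K0/eqP.
  by rewrite scalerBr scalerA ee subrr.
- by left=> v; apply/eqP/K1.
Qed.

Lemma central_idempotentC e :
  central_idempotent e -> central_idempotent (1 - e).
Proof.
move=> [eC ee]; split; first by rewrite rpredB ?rpred1.
by rewrite mulrBr mulr1 mulrBl mul1r ee subrr subr0.
Qed.

Lemma central_idempotentM e f : central_idempotent e -> central_idempotent f ->
  central_idempotent (e * f).
Proof.
move=> [eC ee] [fC ff]; split; first by rewrite rpredM.
have /centralP eC' := eC.
by rewrite -mulrA (mulrA f) -(eC' f) -mulrA ff mulrA ee.
Qed.

Lemma belongs_toP e V : central_idempotent e ->
  belongs_to e V <-> (forall v : V, e *: v = v).
Proof.
move=> [_ ee]; split=> [eV v|eV v]; last by exists v.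
by have [w ->] := eV v; rewrite scalerA ee.
Qed.

(** If [y * (1 - e) = 1], multiplying by [e] gives [e = 0]. So [1 - e] kills a nonzero vector of
    some simple module, where [e] then cannot act as 0. *)
Lemma idempotent_simple e : central_idempotent e -> e != 0 ->
  exists V, simple_module V /\ forall v : V, e *: v = v.
Proof.
move=> eI e0; have [|V [v [Vs v0 ev]]] := @exists_simple_killed B (1 - e).
  move=> y ye; case/eqP: e0; have [_ ee] := eI.
  by rewrite -[LHS]mul1r -ye -mulrA mulrBl mul1r ee subrr mulr0.
exists V; split=> //; case: (central_idempotent_act eI Vs) => // e00.
by case/eqP: v0; move: ev; rewrite scalerBl scale1r e00 subr0.
Qed.

Lemma block_idempotent_act e f : block_idempotent e -> central_idempotent f ->
  e * f = 0 \/ e * f = e.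
Proof.
move=> [eI _ eB] fI; have [eC ee] := eI; have [/centralP fC ff] := fI.
have [||||e0|e0] := eB (e * f) (e * (1 - f)).
- exact: central_idempotentM.
- by apply: central_idempotentM => //; apply: central_idempotentC.
- by rewrite -mulrA (mulrA f) fC -mulrA mulrBr mulr1 ff subrr !mulr0.
- by rewrite mulrBr mulr1 addrC subrK.
- by left.
- by move/eqP: e0; rewrite mulrBr mulr1 subr_eq0 => /eqP; right.
Qed.

End CentralIdempotents.

Section ExtensionFacts.
Variables (R S : comPzRingType) (f : {rmorphism R -> S}) (A : ralg R).

Lemma ext_tensE s a : ext_tens f s a = ralg_map (ext f A) s * ext_tens f 1 a.
Proof. by rewrite [RHS]ext_tensM mulr1 mul1r. Qed.

Lemma ext_tens_map r : ext_tens f 1 (ralg_map A r) = ralg_map (ext f A) (f r).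
Proof.
rewrite -[ralg_map A r]mulr1 -[f r]mulr1.
exact/esym/(@tensZ _ (ralg_mod (ralg_of f)) (ralg_mod A)).
Qed.

Lemma ext_tens1_zmod : zmod_morphism (fun a : A => ext_tens f 1 a).
Proof.
move=> x y; apply: (addIr (ext_tens f 1 y)); rewrite subrK.
by rewrite /ext_tens -[LHS]tensDr subrK.
Qed.

Lemma ext_tens1_monoid : monoid_morphism (fun a : A => ext_tens f 1 a).
Proof. by split=> // x y; rewrite ext_tensM mulr1. Qed.

Lemma ext_central x :
  (forall a : A, x * ext_tens f 1 a = ext_tens f 1 a * x) ->
  x \in @central (ext f A).
Proof.
move=> xA; apply/centralP => y.
elim/tensor_ind: y => [|s a|y z Hy Hz]; first by rewrite mulr0 mul0r.
- rewrite -[tens s a]/(ext_tens f s a) ext_tensE mulrA.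
  by rewrite -(@ralg_central _ (ext f A)) -mulrA xA mulrA.
- by rewrite mulrDr mulrDl Hy Hz.
Qed.

End ExtensionFacts.

HB.instance Definition _ (R : idomainType) (A : ralg R) :=
  GRing.isZmodMorphism.Build A (AK A) (@to_AK R A)
    (ext_tens1_zmod (@tofrac R) (A := A)).
HB.instance Definition _ (R : idomainType) (A : ralg R) :=
  GRing.isMonoidMorphism.Build A (AK A) (@to_AK R A)
    (ext_tens1_monoid (@tofrac R) A).
HB.instance Definition _ (R : idomainType) (A : ralg R) p :=
  GRing.isZmodMorphism.Build A (Aloc A p) (@to_Aloc R A p)
    (ext_tens1_zmod (@to_loc R p) (A := A)).
HB.instance Definition _ (R : idomainType) (A : ralg R) p :=
  GRing.isMonoidMorphism.Build A (Aloc A p) (@to_Aloc R A p)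
    (ext_tens1_monoid (@to_loc R p) A).

Lemma to_AKM (R : idomainType) (A : ralg R) : {morph @to_AK R A : x y / x * y}.
Proof. exact: rmorphM. Qed.

Lemma to_AK_map (R : idomainType) (A : ralg R) r :
  to_AK (ralg_map A r) = ralg_map (AK A) (tofrac r).
Proof. exact: ext_tens_map. Qed.

(** * From the localization at a prime to the generic algebra *)

Section LocalizationToField.
Variables (R : idomainType) (A : ralg R) (p : prime_idealr R).
Local Notation Aloc_AK := (@Aloc_AK R A p).

Lemma Aloc_AK_balanced :
  balanced (M := ralg_mod (ralg_of (@to_loc R p))) (N := ralg_mod A)
    (fun x a => tens (loc_val (x : loc p) : ralg_mod (ralg_of (@tofrac R))) a).
Proof.
split=> [x y a|x a b|r x a]; first exact: tensDl; first exact: tensDr.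
exact: (@tensZ _ (ralg_mod (ralg_of (@tofrac R))) (ralg_mod A)).
Qed.

Lemma Aloc_AKE x a : Aloc_AK (ext_tens (@to_loc R p) x a) =
  ext_tens (@tofrac R) (loc_val x) a.
Proof. exact: (tensor_lift_tens Aloc_AK_balanced). Qed.

Lemma Aloc_AKD : {morph Aloc_AK : x y / x + y}.
Proof. exact: (tensor_liftD Aloc_AK_balanced). Qed.

Lemma Aloc_AK0 : Aloc_AK 0 = 0.
Proof. exact: (tensor_lift0 Aloc_AK_balanced). Qed.

Lemma Aloc_AK_zmod : zmod_morphism Aloc_AK.
Proof.
by move=> x y; apply: (addIr (Aloc_AK y)); rewrite -Aloc_AKD !subrK.
Qed.

Lemma Aloc_AK_monoid : monoid_morphism Aloc_AK.
Proof.
split=> [|x y]; first exact: Aloc_AKE.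
elim/tensor_ind: x => [|b a|x x' Hx Hx'].
- by rewrite mul0r Aloc_AK0 mul0r.
- elim/tensor_ind: y => [|b' a'|y y' Hy Hy'].
  + by rewrite mulr0 Aloc_AK0 mulr0.
  + rewrite -[tens b a]/(ext_tens (@to_loc R p) b a).
    rewrite -[tens b' a']/(ext_tens (@to_loc R p) b' a').
    by rewrite ext_tensM !Aloc_AKE ext_tensM.
  + by rewrite mulrDr !Aloc_AKD mulrDr Hy Hy'.
- by rewrite mulrDl !Aloc_AKD mulrDl Hx Hx'.
Qed.

HB.instance Definition _ :=
  GRing.isZmodMorphism.Build (Aloc A p) (AK A) Aloc_AK Aloc_AK_zmod.
HB.instance Definition _ :=
  GRing.isMonoidMorphism.Build (Aloc A p) (AK A) Aloc_AK Aloc_AK_monoid.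

Lemma Aloc_AKM : {morph Aloc_AK : x y / x * y}.
Proof. exact: rmorphM. Qed.

Lemma Aloc_AKB : {morph Aloc_AK : x y / x - y}.
Proof. exact: raddfB. Qed.

Lemma Aloc_AK1 : Aloc_AK 1 = 1.
Proof. exact: rmorph1. Qed.

Lemma Aloc_AK_to a : Aloc_AK (to_Aloc p a) = to_AK a.
Proof. exact: Aloc_AKE. Qed.

Lemma Aloc_AK_map x :
  Aloc_AK (ralg_map (Aloc A p) x) = ralg_map (AK A) (loc_val x).
Proof. exact: Aloc_AKE. Qed.

Lemma Aloc_AK_central x : x \in @central (Aloc A p) ->
  Aloc_AK x \in @central (AK A).
Proof.
move=> /centralP xC; apply: ext_central => a.
by rewrite -[ext_tens _ _ a]/(to_AK a) -Aloc_AK_to -!rmorphM xC.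
Qed.

Lemma Aloc_AK_idempotent e : central_idempotent e ->
  central_idempotent (Aloc_AK e).
Proof.
by move=> [eC ee]; split; [apply: Aloc_AK_central|rewrite -rmorphM ee].
Qed.

Lemma to_AlocM : {morph @to_Aloc R A p : x y / x * y}.
Proof. exact: rmorphM. Qed.

Lemma to_AlocD : {morph @to_Aloc R A p : x y / x + y}.
Proof. exact: rmorphD. Qed.

Lemma to_Aloc_map r :
  to_Aloc p (ralg_map A r) = ralg_map (Aloc A p) (to_loc p r).
Proof. exact: ext_tens_map. Qed.

(** Common denominators: a pure tensor inherits that of its scalar, and a sum takes the product of
    two. *)
Lemma Aloc_fraction (x : Aloc A p) :
  exists2 s : R, s \notin p &
    exists a : A, ralg_map (Aloc A p) (to_loc p s) * x = to_Aloc p a.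
Proof.
elim/tensor_ind: x => [|b a|x y [s ps [a Ha]] [t pt [b Hb]]].
- by exists 1; [rewrite idealr1|exists 0; rewrite mulr0 rmorph0].
- have /loc_predP[r [s [ps brs]]] := loc_valP (b : loc p).
  exists s => //; exists (ralg_map A r * a).
  rewrite -[tens b a]/(ext_tens (@to_loc R p) b a) ext_tensE mulrA -rmorphM.
  rewrite to_AlocM to_Aloc_map; congr (ralg_map _ _ * _); apply: val_inj.
  by rewrite /= brs mulrC divfK // (notin_prime_neq0 ps).
- exists (s * t); first exact: notin_primeM.
  exists (ralg_map A t * a + ralg_map A s * b).
  have stE u v w : ralg_map (Aloc A p) (to_loc p (u * v)) * w =
      ralg_map (Aloc A p) (to_loc p u) * (ralg_map (Aloc A p) (to_loc p v) * w).
    by rewrite mulrA -!rmorphM.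
  have CE u v (w : Aloc A p) :
      ralg_map (Aloc A p) u * (ralg_map (Aloc A p) v * w) =
      ralg_map (Aloc A p) v * (ralg_map (Aloc A p) u * w).
    by rewrite !mulrA -!rmorphM mulrC.
  by rewrite to_AlocD !to_AlocM !to_Aloc_map -Ha -Hb mulrDr !stE CE.
Qed.

End LocalizationToField.

(** * Flatness and finite generation *)

Section Flatness.
Variables (R : idomainType) (A : ralg R).

Definition loc_val_lin (p : prime_idealr R)
  (x : ralg_mod (ralg_of (@to_loc R p))) : ralg_mod (ralg_of (@tofrac R)) :=
  loc_val (x : loc p).

Lemma loc_val_linP p : linear (@loc_val_lin p).
Proof. by []. Qed.

HB.instance Definition _ p :=
  GRing.isLinear.Build R _ _ *:%R (@loc_val_lin p) (@loc_val_linP p).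

Definition tofrac_lin (x : R^o) : ralg_mod (ralg_of (@tofrac R)) :=
  tofrac (x : R).

Lemma tofrac_linP : linear tofrac_lin.
Proof.
by move=> a x y; rewrite restr_scaleE /tofrac_lin tofracD tofracM.
Qed.

HB.instance Definition _ :=
  GRing.isLinear.Build R _ _ *:%R tofrac_lin tofrac_linP.

Hypothesis A_flat : flat (ralg_mod A).

Lemma Aloc_AK_inj p : injective (@Aloc_AK R A p).
Proof. by apply: (A_flat (f := @loc_val_lin p)) => x y; apply: val_inj. Qed.

(** Tensoring the inclusion of [R] in its fraction field with [A] is injective by flatness, and
    multiplication from the tensor product of [R] and [A] to [A] recovers [a] from the tensor of 1
    and [a]. *)
Lemma to_AK_inj : injective (@to_AK R A).
Proof.
move=> a b eab; have tinj : injective tofrac_lin.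
  by move=> x y /eqP; rewrite tofrac_eq => /eqP.
have mapE c :
    tensor_map tofrac_lin id (tens (1 : R^o) (c : ralg_mod A)) = to_AK c.
  rewrite /tensor_map tensor_lift_tens; first by rewrite /tofrac_lin tofrac1.
  split=> [x y n|x m n|r x n]; last by rewrite linearZ; apply: tensZ.
    by rewrite raddfD; apply: tensDl.
  exact: tensDr.
have /(congr1 (tensor_lift (fun (r : R^o) (c : ralg_mod A) => (r : R) *: c))) :
    tens (1 : R^o) (a : ralg_mod A) = tens (1 : R^o) (b : ralg_mod A).
  by apply: (A_flat tinj); rewrite !mapE.
rewrite !tensor_lift_tens ?scale1r //; split=> *;
  by rewrite ?scalerDl ?scalerDr // scalerA mulrC.
Qed.

Lemma to_Aloc_inj p : injective (@to_Aloc R A p).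
Proof.
move=> a b /(congr1 (@Aloc_AK R A p)); rewrite !Aloc_AK_to; exact: to_AK_inj.
Qed.

(** The numerator is central because its image in [Aloc A p] is, and [A] embeds there. *)
Lemma Aloc_fraction_central p (x : Aloc A p) : x \in @central (Aloc A p) ->
  exists2 s : R, s \notin p & exists z : center A,
    ralg_map (Aloc A p) (to_loc p s) * x = to_Aloc p (center_val z).
Proof.
move=> xC; have [s ps [a Ha]] := Aloc_fraction x; exists s => //.
have aC : a \in @central A.
  apply/centralP => b; apply: (@to_Aloc_inj p); rewrite !to_AlocM -Ha.
  have /centralP xC' := xC.
  by rewrite -mulrA xC' mulrA ralg_central mulrA.
by exists (Center aC).
Qed.

End Flatness.

(** * Linear dependence, integrality and nilpotence from finite generation *)

Section FiniteGeneration.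
Variables (R : idomainType) (A : ralg R).
Hypothesis A_fin_gen : fin_gen (ralg_mod A).

Local Notation K := {fraction R}.
Local Notation Kmap := (ralg_map (AK A)).

(** With [n] the number of generators, the [m] by [n] coefficient matrix has more rows than columns,
    and any nonzero vector of its left kernel serves. Finite dimension of [AK A] is used in this
    form. *)
Lemma linear_dependence : exists n, forall m (x : 'I_m -> A), (n < m)%N ->
  exists2 c : 'I_m -> K, (exists i, c i != 0) &
    \sum_i Kmap (c i) * to_AK (x i) = 0.
Proof.
have [s sP] := A_fin_gen; exists (size s) => m x nm.
have /choice[d dP] : forall i, exists c : 'I_(size s) -> R,
    x i = \sum_j c j *: s`_j by move=> i; apply: sP.
pose M := \matrix_(i < m, j < size s) tofrac (d i j).
have [u uM u0] : exists2 u : 'rV_m, u *m M = 0 & u != 0.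
  have : kermx M != 0.
    rewrite -mxrank_eq0 mxrank_ker -lt0n subn_gt0.
    exact: leq_ltn_trans (rank_leq_col M) nm.
  case/rowV0Pn=> u /sub_kermxP uM u0; by exists u.
exists (fun i => u 0 i).
  apply/existsP; apply: contraNT u0 => /existsPn u0; apply/eqP/rowP => i.
  by rewrite mxE; apply/eqP; rewrite -[_ == _]negbK.
have -> : \sum_i Kmap (u 0 i) * to_AK (x i) =
    \sum_i \sum_j Kmap (u 0 i * tofrac (d i j)) * to_AK (s`_j : A).
  apply: eq_bigr => i _; rewrite dP raddf_sum /= mulr_sumr.
  apply: eq_bigr => j _; rewrite restr_scaleE.
  by rewrite -[_ *: _]/(ralg_map A (d i j) * _) to_AKM to_AK_map mulrA -rmorphM.
rewrite exchange_big big1 // => j _; rewrite -mulr_suml -raddf_sum.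
have -> : \sum_i u 0 i * tofrac (d i j) = (u *m M) 0 j.
  by rewrite mxE; apply: eq_bigr => i _; rewrite mxE.
by rewrite uM mxE raddf0 mul0r.
Qed.

(** Determinant trick: [z] acts on the generators of [A] by a matrix [D] over [R], and [c] is a root
    of its characteristic polynomial. *)
Lemma integral_scalar (S : lmodType (AK A)) (v : S) (z : center A) (c : K) :
  v != 0 -> (forall w : S, to_AK (center_val z) *: w = Kmap c *: w) ->
  integralOver (@tofrac R) c.
Proof.
move=> v0 zc; have [s sP] := A_fin_gen.
have /choice[d dP] : forall i : 'I_(size s), exists c : 'I_(size s) -> R,
    (center_val z * (s`_i : A)) = \sum_j c j *: s`_j.
  by move=> i; apply: sP.
pose D := \matrix_(i, j) d i j; pose N := c%:M - map_mx (@tofrac R) D.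
pose w (j : 'I_(size s)) : restr Kmap S := to_AK (s`_j : A) *: v.
have toZ r (a : ralg_mod A) : to_AK (r *: a : ralg_mod A) *: v =
    tofrac r *: ((to_AK (a : A) *: v : S) : restr Kmap S).
  by rewrite !restr_scaleE scalerA -to_AK_map -to_AKM.
have Nw i : \sum_j N i j *: w j = 0.
  under eq_bigr do rewrite /N !mxE scalerBl.
  rewrite sumrB (bigD1 i) //= eqxx big1 ?addr0 => [|j /negPf ji]; last first.
    by rewrite eq_sym ji scale0r.
  apply/eqP; rewrite subr_eq0; apply/eqP.
  transitivity (to_AK (center_val z * (s`_i : A)) *: v : S).
    by rewrite mulr1n restr_scaleE /w -zc scalerA -to_AKM.
  rewrite dP raddf_sum scaler_suml; apply: eq_bigr => j _; exact: toZ.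
(* 1 is a combination of the generators, so they cannot all kill [v]. *)
have [j wj] : exists j, w j != 0.
  apply/existsP; apply: contraNT v0 => /existsPn w0.
  have [e eP] := sP (1 : A).
  rewrite -[v]scale1r -(rmorph1 (@to_AK R A)) eP raddf_sum scaler_suml.
  apply/eqP/big1 => j _; rewrite [LHS]toZ -/(w j).
  by have := w0 j; rewrite negbK => /eqP ->; rewrite scaler0.
(* Multiplying by the adjugate turns [N w = 0] into [\det N *: w j = 0], here for a nonzero
   [w j]. *)
have detN : \det N = 0.
  apply/eqP; have : \det N *: w j = 0.
    transitivity (\sum_i (\adj N *m N) j i *: w i).
      rewrite mul_adj_mx (bigD1 j) //= !mxE eqxx big1 ?addr0 ?mulr1n //.
      by move=> i /negPf ij; rewrite !mxE eq_sym ij scale0r.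
    transitivity (\sum_i \sum_l (\adj N j l * N l i) *: w i).
      by apply: eq_bigr => i _; rewrite mxE scaler_suml.
    rewrite exchange_big big1 // => l _.
    under eq_bigr do rewrite -scalerA.
    by rewrite -scaler_sumr Nw scaler0.
  move/eqP; rewrite scaler_eq0 (negPf wj) orbF //.
exists (char_poly D); first exact: char_poly_monic.
rewrite map_char_poly -eigenvalue_root_char.
have /eqP/det0P[u u0 uN] := detN; apply/eigenvalueP; exists u => //.
apply/eqP; rewrite -mul_mx_scalar -subr_eq0 -mulmxBr -oppr_eq0 -mulmxN.
by rewrite opprB uN.
Qed.

(* In a linear relation z^m (c + z h) = 0 with c != 0, the factor c + z h acts
   as c on every simple module, so it is left invertible. *)
Lemma killed_nilpotent (z : center A) :
  (forall S : lmodType (AK A), simple_module S ->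
    forall v : S, to_AK (center_val z) *: v = 0) ->
  exists m, to_AK (center_val z) ^+ m = 0.
Proof.
move=> zk; have [n nP] := linear_dependence.
set y := to_AK _; have yC : y \in @central (AK A) by apply: to_AK_central.
have yXC k : y ^+ k \in @central (AK A) by apply: rpredX.
have [c [i0 ci0] cy] := nP n.+1 (fun i => center_val z ^+ i) (ltnSn n).
have [/= m cm mmin] := @arg_minnP _ i0 (fun i => c i != 0) val ci0.
pose w := \sum_(i < n.+1 | (m <= i)%N) Kmap (c i) * y ^+ (i - m)%N.
have yw : y ^+ m * w = 0.
  rewrite -cy (bigID (fun i : 'I_n.+1 => (m <= i)%N)) /=.
  rewrite [X in _ = _ + X]big1 ?addr0.
    rewrite /w mulr_sumr; apply: eq_bigr => i mi; have /centralP -> := yXC m.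
    by rewrite -mulrA -exprD subnK // rmorphXn.
  move=> i; apply: contraNeq => yi; apply: mmin.
  by apply: contraNneq yi => ->; rewrite rmorph0 mul0r.
(* Otherwise [w] kills a nonzero vector of a simple module; there every positive power of [y] acts
   as 0, leaving the invertible scalar [c m]. *)
exists m; have [t tw] : exists t, t * w = 1.
  apply: contrapT => /forallNP /exists_simple_killed[V [v [Vs v0 wv]]].
  case/eqP: v0; have : Kmap (c m) *: v = 0.
    rewrite -wv /w (bigD1 m) //= subnn expr0 mulr1 scalerDl scaler_suml.
    rewrite big1 ?addr0 // => i /andP[mi im].
    have /prednK <- : (0 < i - m)%N by rewrite subn_gt0 ltn_neqAle eq_sym im.
    by rewrite exprSr -!scalerA zk // !scaler0.
  move=> /(congr1 ( *:%R (Kmap (c m)^-1))).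
  by rewrite scalerA -rmorphM mulVf // rmorph1 scale1r scaler0.
rewrite -[LHS]mul1r -tw -mulrA.
by have /centralP <- := yXC m; rewrite yw mulr0.
Qed.

End FiniteGeneration.

(** * Central characters *)

(** A duplicate-free list in [X] of maximal length exhausts [X], as a missing element could be
    added. *)
Lemma bounded_uniq_enum (T : eqType) (X : set T) n :
  (forall s : seq T, uniq s -> (forall x, x \in s -> X x) -> (size s <= n)%N) ->
  exists s : seq T, forall x, X x <-> x \in s.
Proof.
move=> Xn; pose P k := `[< exists s : seq T,
  [/\ uniq s, forall x, x \in s -> X x & size s = k] >].
have exP : exists k, P k by exists 0%N; apply/asboolP; exists [::].
have Pn k : P k -> (k <= n)%N by move=> /asboolP[s [us sX <-]]; apply: Xn.
case: (ex_maxnP exP Pn) => k /asboolP[s [us sX sk]] kmax; exists s => x.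
split=> [Xx|]; last exact: sX.
apply: contraT => xs; suff /kmax : P k.+1 by rewrite ltnn.
apply/asboolP; exists (x :: s); split=> [|y|]; rewrite /= ?xs ?us ?sk //.
by rewrite inE => /orP[/eqP ->|/sX].
Qed.

(** Elements comaximal with a fixed one are closed under products, so powers can be taken on one
    side and then, after swapping, on the other. *)
Lemma comaximal_exp (C : comPzRingType) (a b : C) m : a + b = 1 ->
  exists h k, a ^+ m * h + b ^+ m * k = 1.
Proof.
have mul (x y z : C) : (exists h k, x * h + z * k = 1) ->
    (exists h k, y * h + z * k = 1) -> exists h k, (x * y) * h + z * k = 1.
  move=> [h [k e]] [h' [k' e']]; exists (h * h'), (x * h * k' + k).
  rewrite -e -[in RHS](mulr1 (x * h)) -e' mulrDr [in RHS]mulrDr addrA.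
  by rewrite mulrACA [z * (_ * _)]mulrCA.
have exp (x z : C) : (exists h k, x * h + z * k = 1) ->
    exists h k, x ^+ m * h + z * k = 1.
  move=> xz; elim: m => [|n IHn]; last by rewrite exprS; apply: mul.
  by exists 1, 0; rewrite mulr0 addr0 mulr1.
have sym (x z : C) : (exists h k, x * h + z * k = 1) ->
    exists h k, z * h + x * k = 1.
  by move=> [h [k e]]; exists k, h; rewrite addrC.
by move=> ab; apply/exp/sym/exp/sym; exists 1, 1; rewrite !mulr1.
Qed.

(** Take [g = a ^+ m.+1 * h] with complement [b ^+ m.+1 * k]: then [g * (1 - g)] is a multiple of a
    vanishing power of [a * b]. The exponent [m.+1] leaves a factor [a], resp. [b], to split off
    even when [m = 0]. *)
Lemma lift_idempotent (C : comPzRingType) (a b : C) m :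
  a + b = 1 -> (a * b) ^+ m = 0 ->
  exists g h k, [/\ g * g = g, g = a * h & 1 - g = b * k].
Proof.
move=> ab abm; have [h [k hk]] := comaximal_exp m.+1 ab.
have gE : 1 - a ^+ m.+1 * h = b ^+ m.+1 * k by rewrite -hk addrC addKr.
exists (a ^+ m.+1 * h), (a ^+ m * h), (b ^+ m * k).
split; last by rewrite gE exprS mulrA.
  set g := _ * h; apply/esym/eqP; rewrite -subr_eq0 -{1}[g]mulr1 -mulrBr gE.
  by rewrite mulrACA -exprMn exprS abm mulr0 mul0r.
by rewrite exprS mulrA.
Qed.

Section CentralCharacters.
Variables (R : idomainType) (A : ralg R).
Hypotheses (R_normal : normal_domain R) (A_fin_gen : fin_gen (ralg_mod A)).
Hypotheses (A_flat : flat (ralg_mod A)) (AK_split : split_algebra (AK A)).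

Local Notation K := {fraction R}.
Local Notation Kmap := (ralg_map (AK A)).
Implicit Types (S T : lmodType (AK A)) (z : center A).

(** Neither default of [xget] occurs: splitness provides the scalar in the fraction field, and
    integrality with normality puts it in [R]. *)
Lemma Omega'P S : simple_module S -> forall z (v : S),
  to_AK (center_val z) *: v = Kmap (tofrac (Omega' S z)) *: v.
Proof.
move=> Ss z v; pose zK := Center (to_AK_central z).
have OP (w : S) : center_val zK *: w = Kmap (Omega S zK) *: w.
  have /xgetPex : exists c : K,
    [set k | forall v : S, center_val zK *: v = Kmap k *: v]%classic c.
    exact: (split_central_scalar Ss AK_split (to_AK_central z)).
  exact.
have [u u0] := Ss.1.
have [r rO] := R_normal (integral_scalar A_fin_gen u0 (z := z) OP).
suff -> : tofrac (Omega' S z) = Omega S zK by apply: OP.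
rewrite /Omega'.
apply: (xgetPex 0 (P := [set r | tofrac r = Omega S zK]%classic)).
by exists r.
Qed.

Lemma Kmap_inj S (v : S) c d : v != 0 -> Kmap c *: v = Kmap d *: v -> c = d.
Proof.
move=> v0 /eqP; rewrite -subr_eq0 -scalerBl -rmorphB => /eqP cdv.
apply/eqP; rewrite -subr_eq0; apply: contraNT v0 => cd.
by rewrite -[v]scale1r -(rmorph1 Kmap) -(mulVf cd) rmorphM -scalerA cdv scaler0.
Qed.

Lemma Omega'_eq S z r (v : S) : simple_module S -> v != 0 ->
  to_AK (center_val z) *: v = Kmap (tofrac r) *: v -> Omega' S z = r.
Proof.
move=> Ss v0; rewrite Omega'P // => /(Kmap_inj v0)/eqP.
by rewrite tofrac_eq => /eqP.
Qed.

Lemma Omega'_map S r : simple_module S -> Omega' S (to_center A r) = r.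
Proof.
move=> Ss; have [v v0] := Ss.1.
by apply: (Omega'_eq Ss v0); rewrite to_AK_map.
Qed.

Lemma Omega'B S y z : simple_module S ->
  Omega' S (y - z) = Omega' S y - Omega' S z.
Proof.
move=> Ss; have [v v0] := Ss.1; apply: (Omega'_eq Ss v0).
by rewrite tofracB [in RHS]rmorphB [RHS]scalerBl -!Omega'P // !rmorphB scalerBl.
Qed.

Lemma Omega'M S y z : simple_module S ->
  Omega' S (y * z) = Omega' S y * Omega' S z.
Proof.
move=> Ss; have [v v0] := Ss.1; apply: (Omega'_eq Ss v0).
by rewrite to_AKM tofracM rmorphM -!scalerA -!Omega'P.
Qed.

Lemma Omega'1 S : simple_module S -> Omega' S 1 = 1.
Proof.
move=> Ss; have [v v0] := Ss.1; apply: (Omega'_eq Ss v0).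
by rewrite tofrac1 !rmorph1.
Qed.

(** Characters are taken as functions on the center instead of isomorphism classes of modules, so
    that finiteness can be stated with lists. *)
Definition is_char (chi : center A -> R) :=
  exists2 S, simple_module S & chi = Omega' S.

(** The witness is a product of factors [y - chi y], one for each [chi] in [s]: each vanishes at its
    [chi] and takes at [S] a value in the multiplicative set [D]. It is used with [D] the nonzero
    elements and with [D] the complement of [p]. *)
Lemma separate_chars (D : R -> Prop) S (s : seq (center A -> R)) :
  simple_module S -> D 1 -> (forall a b, D a -> D b -> D (a * b)) ->
  (forall chi, chi \in s -> is_char chi /\ exists z, D (Omega' S z - chi z)) ->
  exists2 z, D (Omega' S z) & forall chi, chi \in s -> chi z = 0.
Proof.
move=> Ss D1 DM; elim: s => [|chi s IHs] sD.
  by exists 1; rewrite ?Omega'1.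
have [|z Dz zs] := IHs.
  by move=> psi psis; apply: sD; rewrite inE psis orbT.
have [[T Ts chiE] [y Dy]] := sD chi (mem_head _ _).
exists ((y - to_center A (chi y)) * z).
  by rewrite Omega'M // Omega'B // Omega'_map //; apply: DM.
move=> psi; rewrite inE => /orP[/eqP ->|psis].
  by rewrite chiE Omega'M // Omega'B // Omega'_map // subrr mul0r.
have [|[T' Ts' psiE] _] := sD psi; first by rewrite inE psis orbT.
by rewrite psiE Omega'M // -psiE zs // mulr0.
Qed.

(** Suppose a list of distinct characters is longer than the bound of [linear_dependence]. Elements
    [z i], nonzero at [chi i] and zero at the other characters, are then dependent; letting the
    relation act on the module of [chi i] forces [c i = 0]. *)
Lemma finite_chars : exists s : seq (center A -> R),
  forall chi, is_char chi <-> chi \in s.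
Proof.
have [n nP] := linear_dependence A_fin_gen.
apply: (@bounded_uniq_enum _ is_char n) => s us sX.
rewrite leqNgt; apply/negP => ns.
pose chi (i : 'I_(size s)) := nth (fun=> 0) s i.
have chis i : chi i \in s by apply: mem_nth.
have /choice[z zP] : forall i : 'I_(size s), exists z : center A,
    (chi i) z != 0 /\ forall j : 'I_(size s), j != i -> (chi j) z = 0.
  move=> i; have [S Ss SE] := sX _ (chis i).
  have [|||z z0 zs] := @separate_chars (fun r => r != 0) S (rem (chi i) s) Ss.
  - exact: oner_neq0.
  - by move=> a b a0 b0; rewrite mulf_neq0.
  - move=> psi; rewrite mem_rem_uniq // inE => /andP[ne psis].
    split; first exact: sX.
    apply: contrapT => /forallNP all0; case/eqP: ne; apply/funext => z.
    rewrite SE; apply/esym/eqP; rewrite -subr_eq0; apply: contrapT => /negP.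
    exact: all0.
  exists z; split=> [|j ji]; first by rewrite SE.
  by apply: zs; rewrite mem_rem_uniq // inE chis andbT nth_uniq.
have [c [i ci] cz] := nP _ (fun i => center_val (z i)) ns.
have [S Ss SE] := sX _ (chis i).
have [v v0] := Ss.1; case/eqP: ci.
have : Kmap (c i * tofrac (Omega' S (z i))) *: v = 0.
  rewrite -[RHS](scale0r v) -cz scaler_suml (bigD1 i) //=.
  rewrite big1 ?addr0 => [|j ji].
    by rewrite rmorphM -scalerA -Omega'P // scalerA.
  rewrite -scalerA Omega'P // -SE (zP j).2; last by rewrite eq_sym.
  by rewrite tofrac0 rmorph0 scale0r scaler0.
rewrite -(scale0r v) -(rmorph0 Kmap) => /(Kmap_inj v0)/eqP.
by rewrite mulf_eq0 tofrac_eq0 -SE (negPf (zP i).1) orbF => /eqP.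
Qed.

Lemma chars_nilpotent z : (forall chi, is_char chi -> chi z = 0) ->
  exists m, z ^+ m = 0.
Proof.
move=> z0; have [|m zm] := @killed_nilpotent _ _ A_fin_gen z.
  move=> S Ss v; rewrite Omega'P // z0; last by exists S.
  by rewrite tofrac0 rmorph0 scale0r.
exists m; apply: val_inj; apply: (to_AK_inj A_flat).
rewrite raddf0 -zm -rmorphXn; congr to_AK.
by elim: m {zm} => // m; rewrite !exprS /= => ->.
Qed.

End CentralCharacters.

(** * Blocks at a prime *)

Section PrimeBlocks.
Variables (R : idomainType) (A : ralg R).
Hypotheses (R_normal : normal_domain R) (A_fin_gen : fin_gen (ralg_mod A)).
Hypotheses (A_flat : flat (ralg_mod A)) (AK_split : split_algebra (AK A)).
Variable p : prime_idealr R.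

Local Notation K := {fraction R}.
Local Notation Kmap := (ralg_map (AK A)).
Local Notation Aloc_AK := (@Aloc_AK R A p).
Local Notation Omega'P := (Omega'P R_normal A_fin_gen AK_split).
Local Notation Omega'M := (Omega'M R_normal A_fin_gen AK_split).
Local Notation Omega'B := (Omega'B R_normal A_fin_gen AK_split).
Local Notation Omega'1 := (Omega'1 R_normal A_fin_gen AK_split).
Local Notation Omega'_map := (Omega'_map R_normal A_fin_gen AK_split).
Implicit Types (S T : lmodType (AK A)) (y z : center A).
Implicit Types chi psi : center A -> R.

Definition congr_chars chi psi := forall z, chi z - psi z \in p.

Lemma congr_chars_refl chi : congr_chars chi chi.
Proof. by move=> z; rewrite subrr idealr0. Qed.

Lemma congr_chars_sym chi psi : congr_chars chi psi -> congr_chars psi chi.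
Proof. by move=> e z; rewrite -opprB rpredN. Qed.

Lemma congr_chars_trans chi psi phi :
  congr_chars chi psi -> congr_chars psi phi -> congr_chars chi phi.
Proof. by move=> e e' z; rewrite -(subrKA (psi z)) rpredD. Qed.

(** [y] is the product, over the characters [chi] congruent to that of [S], of factors [chi z - z]
    with [z] outside [p] at [chi] and zero at all non-congruent characters. Such a factor vanishes
    at [chi] and equals the constant [chi z] at every character outside the class. *)
Lemma separate_class S : simple_module S -> exists y u,
  [/\ u \notin p,
      forall T, simple_module T -> congr_chars (Omega' S) (Omega' T) ->
        Omega' T y = 0 &
      forall T, simple_module T -> ~ congr_chars (Omega' S) (Omega' T) ->
        Omega' T y = u].
Proof.
move=> Ss; have [s sP] := finite_chars R_normal A_fin_gen AK_split.
pose far := [seq psi <- s | `[< ~ congr_chars (Omega' S) psi >]].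
have sep T : simple_module T -> congr_chars (Omega' S) (Omega' T) ->
    exists2 z, Omega' T z \notin p & forall psi, psi \in far -> psi z = 0.
  move=> Ts ST; apply: (separate_chars R_normal A_fin_gen AK_split
    (D := fun r => r \notin p)) => // [|a b|psi].
  - by rewrite idealr1.
  - exact: notin_primeM.
  - rewrite mem_filter => /andP[/asboolP Spsi /sP psiX]; split=> //.
    apply: contrapT => /forallNP Tpsi; apply: Spsi.
    apply: congr_chars_trans ST _ => z; apply: contrapT => /negP.
    exact: Tpsi.
have [y [u [pu yt yf]]] : exists y u, [/\ u \notin p,
    forall psi, psi \in s -> congr_chars (Omega' S) psi -> psi y = 0 &
    forall psi, psi \in far -> psi y = u].
  have : forall psi, psi \in s -> is_char psi by move=> psi /sP.
  (* The induction consumes only the list of factors; [far] still refers to the full list [s]. *)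
  elim: {1 2}s => [_|psi t IHt tX].
    exists 1, 1; split=> [|//|psi]; first by rewrite idealr1.
    by rewrite mem_filter => /andP[_ /sP[T Ts ->]]; rewrite Omega'1.
  have [|y [u [pu yt yf]]] := IHt.
    by move=> phi phit; apply: tX; rewrite inE phit orbT.
  have [Spsi|Spsi] := pselect (congr_chars (Omega' S) psi); last first.
    exists y, u; split=> // phi; rewrite inE => /orP[/eqP -> //|]; exact: yt.
  have [T Ts psiE] := tX psi (mem_head _ _); rewrite psiE in Spsi.
  have [z pz zf] := sep T Ts Spsi.
  exists ((to_center A (Omega' T z) - z) * y), (Omega' T z * u).
  split=> [|phi phit Sphi|phi phif]; first exact: notin_primeM.
    have [T' Ts' phiE] := tX phi phit.
    rewrite phiE Omega'M // Omega'B // Omega'_map //.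
    move: phit; rewrite inE => /orP[/eqP phiT|/yt yphi].
      by rewrite -phiE phiT psiE subrr mul0r.
    by rewrite -phiE yphi // mulr0.
  have /sP[T' Ts' phiE] : phi \in s.
    by move: phif; rewrite mem_filter => /andP[].
  rewrite phiE Omega'M // Omega'B // Omega'_map // -phiE.
  by rewrite (zf phi) // (yf phi) // subr0.
exists y, u; split=> // T Ts ST.
  by apply: yt => //; apply/sP; exists T.
apply: yf; rewrite mem_filter; apply/andP; split; first exact/asboolP.
by apply/sP; exists T.
Qed.

(** Over [loc p] the element [u] is invertible, so [b = y / u] and [a = (u - y) / u] sum to 1, and
    [a * b] is nilpotent because every character kills [y * (u - y)]. The lifted [g] is a multiple
    of [a], which acts as 0 off the class, and [1 - g] is a multiple of [b], which acts as 0 on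
    it. *)
Lemma class_idempotent S : simple_module S -> exists2 g : Aloc A p,
  central_idempotent g & forall T, simple_module T ->
    (congr_chars (Omega' S) (Omega' T) -> forall v : T, Aloc_AK g *: v = v) /\
    (~ congr_chars (Omega' S) (Omega' T) -> forall v : T, Aloc_AK g *: v = 0).
Proof.
move=> Ss; have [y [u [pu y0 yu]]] := separate_class Ss.
have [m ym] : exists m, (y * (to_center A u - y)) ^+ m = 0.
  apply: (chars_nilpotent R_normal A_fin_gen A_flat AK_split) => _ [T Ts ->].
  rewrite Omega'M // Omega'B // Omega'_map //.
  have [ST|ST] := pselect (congr_chars (Omega' S) (Omega' T)).
    by rewrite y0 // mul0r.
  by rewrite yu // subrr mulr0.
have uV : (tofrac u)^-1 \in @loc_pred R p.
  by apply/loc_predP; exists 1, u; rewrite tofrac1 div1r.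
pose ui : loc p := Loc uV.
have uiK : ui * to_loc p u = 1.
  by apply: val_inj; rewrite /= mulVf // (notin_prime_neq0 pu).
have toC z : to_Aloc p (center_val z) \in @central (Aloc A p).
  apply: ext_central => a; rewrite -[ext_tens _ _ a]/(to_Aloc p a) -!to_AlocM.
  by have /centralP -> := center_valP z.
pose iota z : center (Aloc A p) := Center (toC z).
have iotaM y' z' : iota (y' * z') = iota y' * iota z'.
  by apply: val_inj; apply: to_AlocM.
pose U : center (Aloc A p) := to_center (Aloc A p) ui.
pose b : center (Aloc A p) := U * iota y.
pose a : center (Aloc A p) := U * iota (to_center A u - y).
have ab1 : a + b = 1.
  apply: val_inj; rewrite /= -mulrDr -to_AlocD subrK to_Aloc_map -rmorphM.
  by rewrite uiK rmorph1.
have abm : (a * b) ^+ m = 0.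
  rewrite mulrC mulrACA -iotaM exprMn.
  have -> : iota (y * (to_center A u - y)) ^+ m = iota 0.
    rewrite -ym; elim: (m) => [|n IHn].
      by apply: val_inj; rewrite /= rmorph1.
    by rewrite !exprS IHn -iotaM.
  by rewrite (_ : iota 0 = 0) ?mulr0 //; apply: val_inj; rewrite /= rmorph0.
have [g [h [k [gg ga gb]]]] := lift_idempotent ab1 abm.
exists (center_val g).
  split; first exact: center_valP.
  by have := congr1 val gg.
have UE z T (v : T) : Aloc_AK (center_val (U * iota z)) *: v =
    Kmap (tofrac u)^-1 *: (to_AK (center_val z) *: v).
  rewrite -[center_val _]/(ralg_map (Aloc A p) ui * to_Aloc p (center_val z)).
  by rewrite Aloc_AKM Aloc_AK_map Aloc_AK_to scalerA.
move=> T Ts; split=> ST v.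
  have gb0 : Aloc_AK (center_val (1 - g)) *: v = 0.
    rewrite gb mulrC Aloc_AKM -scalerA UE Omega'P // y0 //.
    by rewrite tofrac0 rmorph0 scale0r !scaler0.
  apply/eqP; rewrite eq_sym -subr_eq0 -{1}[v]scale1r -(Aloc_AK1 A p) -scalerBl.
  by rewrite -Aloc_AKB gb0.
rewrite ga mulrC Aloc_AKM -scalerA UE Omega'P // Omega'B // Omega'_map // yu //.
by rewrite subrr tofrac0 rmorph0 scale0r !scaler0.
Qed.

(** Were [e] to act as 0 on [T], clearing its denominator by some [s] outside [p] would give [z] in
    the center with values [s] at [S] and 0 at [T], contradicting congruence. *)
Lemma congr_idempotent_act S T (e : Aloc A p) :
  simple_module S -> simple_module T -> congr_chars (Omega' S) (Omega' T) ->
  central_idempotent e -> (forall v : S, Aloc_AK e *: v = v) ->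
  forall v : T, Aloc_AK e *: v = v.
Proof.
move=> Ss Ts ST eI eS.
have [eT|//] := central_idempotent_act (Aloc_AK_idempotent eI) Ts.
have [s ps [z ez]] := Aloc_fraction_central A_flat eI.1.
have zE (V : lmodType (AK A)) (v : V) : to_AK (center_val z) *: v =
    Kmap (tofrac s) *: (Aloc_AK e *: v).
  by rewrite scalerA -(Aloc_AK_to p) -ez Aloc_AKM Aloc_AK_map.
have [[v v0] [w w0]] := (Ss.1, Ts.1).
have zS : Omega' S z = s.
  by apply: (Omega'_eq R_normal A_fin_gen AK_split Ss v0); rewrite zE eS.
have zT : Omega' T z = 0.
  apply: (Omega'_eq R_normal A_fin_gen AK_split Ts w0).
  by rewrite zE eT scaler0 tofrac0 rmorph0 scale0r.
by have := ST z; rewrite zS zT subr0 (negPf ps).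
Qed.

Lemma idempotent_loc_simple (e : Aloc A p) : central_idempotent e -> e != 0 ->
  exists S, simple_module S /\ forall v : S, Aloc_AK e *: v = v.
Proof.
move=> eI e0; apply: idempotent_simple; first exact: Aloc_AK_idempotent.
apply: contraNneq e0 => e1; apply/eqP/(Aloc_AK_inj A_flat).
by rewrite e1 rmorph0.
Qed.

(** The product [c * d] acts as 1 on [S], hence is nonzero, and primitivity of each factor makes it
    equal to both [c] and [d]. *)
Lemma blocks_eq (c d : Aloc A p) S : block_idempotent c -> block_idempotent d ->
  simple_module S -> (forall v : S, Aloc_AK c *: v = v) ->
  (forall v : S, Aloc_AK d *: v = v) -> c = d.
Proof.
move=> cB dB [[v v0] _] cS dS; have [[cI _ _] [dI _ _]] := (cB, dB).
have cd0 : c * d <> 0.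
  move=> cd; case/eqP: v0; rewrite -(cS v) -{1}(dS v) scalerA -rmorphM.
  by rewrite cd rmorph0 scale0r.
have [//|<-] := block_idempotent_act cB dI.
have /centralP dC := dI.1; rewrite -dC.
by have [|//] := block_idempotent_act dB cI; rewrite dC.
Qed.

(** In an orthogonal decomposition [g = e + f] one summand, say [e], acts as 1 on [S], hence on the
    whole class. A simple module where [f] acts as 1 belongs to the class, so [e * f = 0] leaves
    none and [f = 0]. *)
Lemma class_block S : simple_module S -> exists2 c : Aloc A p,
  block_idempotent c & forall T, pfamily_of c T <->
    simple_module T /\ congr_chars (Omega' S) (Omega' T).
Proof.
move=> Ss; have [g gI gT] := class_idempotent Ss; have [v v0] := Ss.1.
have gS : forall w : S, Aloc_AK g *: w = w.
  by apply: (gT S Ss).1; apply: congr_chars_refl.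
have gP T : simple_module T -> (forall w : T, Aloc_AK g *: w = w) ->
    congr_chars (Omega' S) (Omega' T).
  move=> Ts gid; apply: contrapT => ST; have [w w0] := Ts.1.
  by case/eqP: w0; rewrite -(gid w) (gT T Ts).2.
exists g; last first.
  move=> T; split=> -[Ts]; last first.
    move=> ST; split=> //; apply/belongs_toP; last exact: (gT T Ts).1.
    exact: Aloc_AK_idempotent.
  by move/belongs_toP => gid; split=> //; apply/gP/gid/Aloc_AK_idempotent.
have half e f : central_idempotent e -> central_idempotent f -> e * f = 0 ->
    g = e + f -> (forall w : S, Aloc_AK e *: w = w) -> f = 0.
  move=> eI fI ef0 gef eS; apply/eqP; apply: contrapT => /negP f0.
  have [T [Ts fT]] := idempotent_loc_simple fI f0; have [w w0] := Ts.1.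
  case/eqP: w0; rewrite -(fT w) -[LHS](congr_idempotent_act Ss Ts _ eI eS).
    by rewrite scalerA -rmorphM ef0 rmorph0 scale0r.
  apply: gP => // x; rewrite -[in LHS](fT x) scalerA -rmorphM gef.
  by rewrite mulrDl ef0 add0r fI.2.
split=> //.
  by apply: contraNneq v0 => g0; rewrite -(gS v) g0 rmorph0 scale0r.
move=> e f eI fI ef gef.
have [e0|e1] := central_idempotent_act (Aloc_AK_idempotent eI) Ss; last first.
  by right; apply: (half e).
left; apply: (half f e) => //; first by have /centralP -> := fI.1.
  by rewrite addrC.
by move=> w; rewrite -[RHS]gS gef rmorphD scalerDl e0 add0r.
Qed.

(** Any simple module [S] on which [c] acts as 1 will do: the block idempotent of its class also
    acts as 1 on [S], so [blocks_eq] identifies the two. *)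
Lemma block_class (c : Aloc A p) : block_idempotent c -> exists2 S,
  simple_module S /\ (forall v : S, Aloc_AK c *: v = v) &
  forall T, pfamily_of c T <->
    simple_module T /\ congr_chars (Omega' S) (Omega' T).
Proof.
move=> cB; have [cI c0 _] := cB.
have [S [Ss cS]] := idempotent_loc_simple cI c0; exists S => //.
have [g gB gP] := class_block Ss.
suff -> : c = g by [].
apply: (blocks_eq _ _ Ss cS) => //; have [gI _ _] := gB.
have [_ gS] := (gP S).2 (conj Ss (congr_chars_refl _)).
exact/(belongs_toP _ (Aloc_AK_idempotent gI)).
Qed.

Lemma same_pfamilyP S T : simple_module S -> simple_module T ->
  same_pfamily p S T <-> congr_chars (Omega' S) (Omega' T).
Proof.
move=> Ss Ts; split=> [[F [[c cB FP] /FP FS /FP FT]]|ST].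
  have [S' _ cP] := block_class cB.
  have [[_ SS'] [_ TS']] := ((cP S).1 FS, (cP T).1 FT).
  exact: congr_chars_trans (congr_chars_sym SS') TS'.
have [c cB cP] := class_block Ss.
exists (pfamily_of c); split; first by exists c.
  by apply/cP; split=> //; apply: congr_chars_refl.
exact/cP.
Qed.

Lemma pfamily_simple (F : lmodType (AK A) -> Prop) S :
  is_pfamily p F -> F S -> simple_module S.
Proof. by move=> [c _ FP] /FP[]. Qed.

Lemma ker_OmegapE S z : (z \in ker_Omegap S p) = (Omega' S z \in p).
Proof.
rewrite unfold_in /ker_Omegap /Omegap.
by rewrite -[in RHS](subr0 (Omega' S z)) Quotient.idealrBE raddf0.
Qed.

Lemma ker_Omegap_prime S : simple_module S -> prime_ideal (ker_Omegap S p).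
Proof.
move=> Ss; split.
- split=> [|a u v]; rewrite !ker_OmegapE.
    by rewrite -(subrr 1) Omega'B // subrr idealr0.
  (* The sum is rewritten as [x - (0 - v)], with 0 as [1 - 1], so that everything reduces to
     [Omega'B]. *)
  move=> pu pv; rewrite -[v]opprK -[- v]sub0r.
  rewrite Omega'B // Omega'M // Omega'B // -(subrr 1) Omega'B //.
  rewrite subrr sub0r opprK.
  by rewrite rpredD // idealMr.
- by rewrite ker_OmegapE Omega'1 // idealr1.
- by move=> u v; rewrite !ker_OmegapE Omega'M // prime_idealrM => /orP.
Qed.

Lemma ker_Omegap_over S : simple_module S -> lies_over p (ker_Omegap S p).
Proof. by move=> Ss r; rewrite ker_OmegapE Omega'_map. Qed.

Lemma ker_Omegap_eq S T : simple_module S -> simple_module T ->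
  congr_chars (Omega' S) (Omega' T) -> ker_Omegap S p = ker_Omegap T p.
Proof.
move=> Ss Ts ST; apply/funext => z.
rewrite -[LHS]/(z \in ker_Omegap S p) -[RHS]/(z \in ker_Omegap T p).
by rewrite !ker_OmegapE -[Omega' S z](subrK (Omega' T z)) rpredDl.
Qed.

Lemma prime_over_ker (Q : {pred center A}) : prime_ideal Q -> lies_over p Q ->
  exists2 S, simple_module S & Q = ker_Omegap S p.
Proof.
move=> [[Q0 Ql] Q1 QM] Qp.
have [s sP] := finite_chars R_normal A_fin_gen AK_split.
have QB y z : y \in Q -> z \in Q -> y - z \in Q.
  by move=> Qy Qz; rewrite -[y - z]addrC -[- z]mulN1r; apply: Ql.
have QMl y z : z \in Q -> y * z \in Q.
  by move=> Qz; rewrite -[y * z]addr0; apply: Ql.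
have [S Ss SQ] : exists2 S, simple_module S &
    forall z, Omega' S z = 0 -> z \in Q.
  apply: contrapT => noS.
  (* If no character has its kernel inside [Q], choosing an element of each kernel outside [Q] and
     multiplying gives [y] outside the prime [Q], yet killed by every character and so nilpotent. *)
  have [y yQ ys] : exists2 y, y \notin Q & forall chi, chi \in s -> chi y = 0.
    have : forall chi, chi \in s -> is_char chi by move=> chi /sP.
    elim: {1 2}s => [_|chi t IHt tX]; first by exists 1.
    have [|y yQ yt] := IHt.
      by move=> psi psit; apply: tX; rewrite inE psit orbT.
    have [S Ss SE] := tX chi (mem_head _ _).
    have [z zS zQ] : exists2 z, Omega' S z = 0 & z \notin Q.
      apply: contrapT => noz; apply: noS; exists S => // z zS.
      by apply: contrapT => /negP zQ; apply: noz; exists z.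
    exists (z * y).
      by apply/negP => /QM[]; apply/negP.
    move=> psi psit; have [T Ts TE] := tX psi psit; rewrite TE Omega'M // -TE.
    move: psit; rewrite inE => /orP[/eqP ->|/yt ->]; last by rewrite mulr0.
    by rewrite SE zS mul0r.
  have [|m ym] := chars_nilpotent R_normal A_fin_gen A_flat AK_split (z := y).
    by move=> chi /sP; apply: ys.
  have : y ^+ m \in Q by rewrite ym.
  elim: m {ym} => [|m IHm]; first by rewrite expr0; apply/negP.
  by rewrite exprS => /QM[|//]; apply/negP.
exists S => //; apply/funext => z.
rewrite -[LHS]/(z \in Q) -[RHS]/(z \in ker_Omegap S p) ker_OmegapE -Qp.
(* As [z] differs from the scalar [Omega' S z] by an element of the kernel, [z] is in [Q] exactly
   when this scalar lies in [Q], that is in [p]. *)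
have Qz : z - to_center A (Omega' S z) \in Q.
  by apply: SQ; rewrite Omega'B // Omega'_map // subrr.
apply/idP/idP => [zQ|cQ]; first by rewrite -[to_center _ _](subKr z); apply: QB.
by have := Ql 1 _ _ Qz cQ; rewrite -[1 *: _]/(1 * _) mul1r subrK.
Qed.

Lemma ext_ideal_fraction (Q : {pred center A}) (x : Aloc A p) :
  submod_closed (Q : {pred (center A)^o}) -> ext_ideal Q x ->
  exists2 s : R, s \notin p & exists2 q : center A, q \in Q &
    ralg_map (Aloc A p) (to_loc p s) * x = to_Aloc p (center_val q).
Proof.
move=> [Q0 Ql] [n [w [q [Qq ->]]]].
elim: n w q Qq => [|n IHn] w q Qq.
  exists 1; first by rewrite idealr1.
  by exists 0; rewrite // big_ord0 mulr0 rmorph0.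
rewrite big_ord_recl.
have [s ps [y Qy Hy]] :=
  IHn (fun i => w (lift ord0 i)) _ (fun i => Qq (lift ord0 i)).
have [t pt [z Hz]] := Aloc_fraction_central A_flat (center_valP (w ord0)).
exists (s * t); first exact: notin_primeM.
exists ((to_center A s * z) * q ord0 + to_center A t * y).
  by apply: (Ql _ _ _ (Qq ord0)); rewrite -[_ * y]addr0; apply: Ql.
have stE : ralg_map (Aloc A p) (to_loc p (s * t)) =
    ralg_map (Aloc A p) (to_loc p s) * ralg_map (Aloc A p) (to_loc p t).
  by rewrite -!rmorphM.
rewrite mulrDr to_AlocD !to_AlocM !to_Aloc_map -Hy -Hz; congr (_ + _).
  by rewrite stE !mulrA.
by rewrite stE ralg_central !mulrA; congr (_ * _); rewrite ralg_central.
Qed.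

End PrimeBlocks.

(** * The correspondence between p-families and primes *)

Section Correspondence.
Variables (R : idomainType) (A : ralg R).
Hypotheses (R_normal : normal_domain R) (A_fin_gen : fin_gen (ralg_mod A)).
Hypotheses (A_flat : flat (ralg_mod A)) (AK_split : split_algebra (AK A)).

Local Notation Omega'P := (Omega'P R_normal A_fin_gen AK_split).
Local Notation Omega'_eq := (Omega'_eq R_normal A_fin_gen AK_split).
Implicit Types (F G : lmodType (AK A) -> Prop) (S T : lmodType (AK A)).

Section AtPrime.
Variable p : prime_idealr R.
Local Notation Aloc_AK := (@Aloc_AK R A p).
Local Notation class_block := (class_block R_normal A_fin_gen A_flat AK_split).
Local Notation block_class := (block_class R_normal A_fin_gen A_flat AK_split).

(** Write [s * (1 - c) = z] with [s] outside [p] and [z] in the center. The value of [z] at [S] is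
    [s] if [c] acts as 0 and 0 if [c] acts as 1, so [z] is in the kernel modulo [p] exactly in the
    second case. *)
Lemma ext_ideal_kerP (c : Aloc A p) S : central_idempotent c ->
  simple_module S ->
  ext_ideal (ker_Omegap S p) (1 - c) <-> forall v : S, Aloc_AK c *: v = v.
Proof.
move=> cI Ss; have [v0 v00] := Ss.1.
have sE s (z : center A) (v : S) :
    ralg_map (Aloc A p) (to_loc p s) * (1 - c) = to_Aloc p (center_val z) ->
    to_AK (center_val z) *: v =
    ralg_map (AK A) (tofrac s) *: (v - Aloc_AK c *: v).
  move=> Hz; rewrite -(Aloc_AK_to p) -Hz Aloc_AKM Aloc_AK_map -scalerA.
  by rewrite Aloc_AKB Aloc_AK1 scalerBl scale1r.
split=> [cS|cS].
  have [Qs _ _] := ker_Omegap_prime R_normal A_fin_gen AK_split p Ss.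
  have [s ps [q Qq Hq]] := ext_ideal_fraction A_flat Qs cS.
  have [c0|//] := central_idempotent_act (Aloc_AK_idempotent cI) Ss.
  have qs : Omega' S q = s.
    by apply: (Omega'_eq Ss v00); rewrite (sE _ _ _ Hq) c0 subr0.
  by move: Qq; rewrite ker_OmegapE qs (negPf ps).
have [cC' _] := central_idempotentC cI.
have [s ps [z Hz]] := Aloc_fraction_central A_flat cC'.
have z0 : Omega' S z = 0.
  apply: (Omega'_eq Ss v00); rewrite (sE _ _ _ Hz) cS subrr scaler0.
  by rewrite tofrac0 rmorph0 scale0r.
have sV : (tofrac s)^-1 \in @loc_pred R p.
  by apply/loc_predP; exists 1, s; rewrite tofrac1 div1r.
exists 1%N, (fun=> to_center (Aloc A p) (Loc sV)), (fun=> z).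
split=> [_|]; first by rewrite ker_OmegapE z0 idealr0.
rewrite big_ord1 -Hz mulrA -rmorphM (_ : Loc sV * _ = 1) ?rmorph1 ?mul1r //.
by apply: val_inj; rewrite /= mulVf // (notin_prime_neq0 ps).
Qed.

(** Translates the graph of the bijection into congruence classes; with [prime_over_ker] it yields
    existence and uniqueness in both directions. *)
Lemma pfamily_prime_kerP F S : simple_module S ->
  pfamily_prime p F (ker_Omegap S p) <->
  forall T, F T <-> simple_module T /\ congr_chars p (Omega' S) (Omega' T).
Proof.
move=> Ss; split=> [[c [cB Fc _ _ cS]] T|FS].
  have [cI _ _] := cB; have [S' _ S'P] := block_class cB.
  have [_ SS'] : simple_module S /\ congr_chars p (Omega' S') (Omega' S).
    apply/S'P; split=> //; apply/(belongs_toP _ (Aloc_AK_idempotent cI)).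
    exact/ext_ideal_kerP.
  split=> [/Fc/S'P[Ts S'T]|[Ts ST]].
    by split=> //; apply: congr_chars_trans (congr_chars_sym SS') S'T.
  by apply/Fc/S'P; split=> //; apply: congr_chars_trans SS' ST.
have [c cB cS] := class_block p Ss; have [cI _ _] := cB; exists c; split=> //.
- by move=> T; apply: (iff_trans (FS T)); apply: iff_sym.
- exact: ker_Omegap_prime.
- exact: ker_Omegap_over.
- apply/ext_ideal_kerP => //.
  have [_ gS] := (cS S).2 (conj Ss (congr_chars_refl _ _)).
  exact/(belongs_toP _ (Aloc_AK_idempotent cI)).
Qed.

Lemma is_pfamily_class F : is_pfamily p F -> exists2 S, simple_module S &
  forall T, F T <-> simple_module T /\ congr_chars p (Omega' S) (Omega' T).
Proof.
move=> [c cB Fc]; have [S [Ss _] Sc] := block_class cB; exists S => // T.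
exact: iff_trans (Fc T) (Sc T).
Qed.

Lemma pfamily_prime_uniq F : is_pfamily p F ->
  exists! Q : {pred center A}, pfamily_prime p F Q.
Proof.
move=> /is_pfamily_class[S Ss FS].
exists (ker_Omegap S p); split=> [|Q FQ]; first exact/pfamily_prime_kerP.
(* Any competing [Q] is the kernel of some [T], whose class must be [F]; so [T] is congruent to [S]
   and the kernels agree. *)
have [c [_ _ Qpr Qp _]] := FQ.
have [T Ts QT] := prime_over_ker R_normal A_fin_gen A_flat AK_split Qpr Qp.
rewrite QT in FQ *; have FT := (pfamily_prime_kerP F Ts).1 FQ.
have [_ ST] := (FS T).1 ((FT T).2 (conj Ts (congr_chars_refl _ _))).
exact: ker_Omegap_eq.
Qed.

Lemma prime_pfamily_uniq (Q : {pred center A}) :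
  prime_ideal Q -> lies_over p Q ->
  exists2 F, pfamily_prime p F Q &
    forall F', pfamily_prime p F' Q -> forall S, F' S <-> F S.
Proof.
move=> Qpr Qp.
have [S Ss ->] := prime_over_ker R_normal A_fin_gen A_flat AK_split Qpr Qp.
exists (fun T => simple_module T /\ congr_chars p (Omega' S) (Omega' T)).
  exact/pfamily_prime_kerP.
by move=> F' /(pfamily_prime_kerP _ Ss).
Qed.

Lemma same_pfamily_prime S : simple_module S ->
  pfamily_prime p (same_pfamily p S) (ker_Omegap S p).
Proof.
move=> Ss; apply/pfamily_prime_kerP => // T; split=> [ST|[Ts ST]].
  have Ts : simple_module T.
    by have [F [Fp _ FT]] := ST; apply: pfamily_simple Fp FT.
  by split=> //; apply/same_pfamilyP.
exact/same_pfamilyP.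
Qed.

(** The class idempotent [g] of [S] is central in [AK A], so [b] is orthogonal to it or lies under
    it. The first is impossible because both act as 1 on [S], and the second excludes [T] outside
    the class. *)
Lemma family_congr (b : AK A) S T : block_idempotent b ->
  family_of b S -> family_of b T -> congr_chars p (Omega' S) (Omega' T).
Proof.
move=> bB [Ss bS] [Ts bT]; have [bI _ _] := bB.
move: bS bT => /(belongs_toP _ bI) bS /(belongs_toP _ bI) bT.
have [g gI gP] := class_idempotent R_normal A_fin_gen A_flat AK_split p Ss.
have [[v v0] [w w0]] := (Ss.1, Ts.1); apply: contrapT => ST.
have [bg|bg] := block_idempotent_act bB (Aloc_AK_idempotent gI).
  case/eqP: v0; rewrite -(bS v) -((gP S Ss).1 (congr_chars_refl _ _) v).
  by rewrite scalerA bg scale0r.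
by case/eqP: w0; rewrite -(bT w) -bg -scalerA (gP T Ts).2 ?scaler0.
Qed.

End AtPrime.

Lemma family_inhabited F : is_family F -> exists S, F S.
Proof.
move=> [b bB Fb]; have [bI b0 _] := bB.
have [S [Ss bS]] := idempotent_simple bI b0; exists S.
by apply/Fb; split=> //; apply/belongs_toP.
Qed.

(** The default of [xget] is excluded by [S]; the chosen value comes from some member of [F],
    congruent by [family_congr]. *)
Lemma Omega_fam_congr F S (p : prime_idealr R) z : is_family F -> F S ->
  Omega' S z - Omega_fam F z \in p.
Proof.
move=> [b bB Fb] FS; rewrite /Omega_fam; case: xgetP => [r _ [T FT ->]|noF].
  by apply: (family_congr p bB); apply/Fb.
by case: (noF (Omega' S z)); exists S.
Qed.

(** The elements of the center at which the two characters agree modulo [p] form a subring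
    containing the image of [R]. *)
Lemma alg_generates_congr n (z : 'I_n -> center A) S T (p : prime_idealr R) :
  alg_generates z -> simple_module S -> simple_module T ->
  (forall i, Omega' S (z i) - Omega' T (z i) \in p) ->
  congr_chars p (Omega' S) (Omega' T).
Proof.
move=> zgen Ss Ts zp.
have OB := Omega'B R_normal A_fin_gen AK_split.
have OM := Omega'M R_normal A_fin_gen AK_split.
apply: (zgen (fun x => Omega' S x - Omega' T x \in p)) => [|r|//].
- split=> [|x y xp yp|x y xp yp]; rewrite unfold_in.
  + by rewrite !(Omega'1 R_normal A_fin_gen AK_split) // subrr idealr0.
  + by rewrite !OB // opprD addrACA -opprD rpredB.
  + rewrite !OM // -(subrKA (Omega' S x * Omega' T y)) -mulrBr -mulrBl.
    by rewrite rpredD // prime_idealrM; apply/orP; [right|left].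
- rewrite unfold_in !(Omega'_map R_normal A_fin_gen AK_split) // subrr.
  exact: idealr0.
Qed.

(** With representatives [S] and [S'] of the two families, both sides say that their characters are
    congruent modulo [p]; on the right, generators suffice by [alg_generates_congr]. *)
Lemma gluing_locusE n (z : 'I_n -> center A) F F' :
  alg_generates z -> is_family F -> is_family F' ->
  gluing_locus F F' =
    zero_locus [set Omega_fam F (z i) - Omega_fam F' (z i) | i in setT]%classic.
Proof.
move=> zgen Ff Ff'.
have [[S FS] [S' FS']] := (family_inhabited Ff, family_inhabited Ff').
apply/funext => p; apply/propext; split=> [[G [Gp FG FG']] _ [i _ <-]|pV].
  have [T Ts GT] := is_pfamily_class Gp.
  have [[Ss TS] [Ss' TS']] := ((GT S).1 (FG S FS), (GT S').1 (FG' S' FS')).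
  have SF := Omega_fam_congr p (z i) Ff FS.
  have SF' := Omega_fam_congr p (z i) Ff' FS'.
  have SS' := congr_chars_trans (congr_chars_sym TS) TS' (z i).
  rewrite -(subrKA (Omega' S (z i))) rpredD //.
    by rewrite -opprB rpredN.
  by rewrite -(subrKA (Omega' S' (z i))) rpredD.
have [b bB Fb] := Ff; have [b' bB' Fb'] := Ff'.
have [[Ss _] [Ss' _]] := ((Fb S).1 FS, (Fb' S').1 FS').
have SS' : congr_chars p (Omega' S) (Omega' S').
  apply: (alg_generates_congr zgen) => // i.
  have SF := Omega_fam_congr p (z i) Ff FS.
  have SF' := Omega_fam_congr p (z i) Ff' FS'.
  rewrite -(subrKA (Omega_fam F (z i))) rpredD //.
  rewrite -(subrKA (Omega_fam F' (z i))) rpredD //.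
    by apply: pV; exists i.
  by rewrite -opprB rpredN.
have [c cB cS] := class_block R_normal A_fin_gen A_flat AK_split p Ss.
exists (pfamily_of c); split=> [|T /Fb TF|T /Fb' TF]; first by exists c.
  by apply/cS; split; [case: TF|apply: (family_congr p bB) => //; apply/Fb].
apply/cS; split; first by case: TF.
by apply: (congr_chars_trans SS'); apply: (family_congr p bB') => //; apply/Fb'.
Qed.

End Correspondence.

Theorem theorem1p5 (R : idomainType) (A : ralg R)
    (R_noetherian : noetherian R) (R_normal : normal_domain R)
    (A_fin_gen : fin_gen (ralg_mod A)) (A_flat : flat (ralg_mod A))
    (AK_split : split_algebra (AK A)) :
  (forall p : prime_idealr R,
    [/\ forall F : lmodType (AK A) -> Prop, is_pfamily p F ->
          exists! Q : {pred center A}, pfamily_prime p F Q,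
        forall Q : {pred center A}, prime_ideal Q -> lies_over p Q ->
          exists2 F : lmodType (AK A) -> Prop, pfamily_prime p F Q &
            forall F', pfamily_prime p F' Q -> forall S, F' S <-> F S,
        forall S : lmodType (AK A), simple_module S ->
          pfamily_prime p (same_pfamily p S) (ker_Omegap S p) &
        forall S T : lmodType (AK A), simple_module S -> simple_module T ->
          (same_pfamily p S T <-> forall z, Omega' S z - Omega' T z \in p)])
  /\
  (forall (n : nat) (z : 'I_n -> center A), alg_generates z ->
    forall F F' : lmodType (AK A) -> Prop, is_family F -> is_family F' ->
      ~ (forall S, F S <-> F' S) ->
      gluing_locus F F' =
        zero_locus [set Omega_fam F (z i) - Omega_fam F' (z i) | i in setT]%classic).
Proof.
split=> [p|n z zgen F F' Ff Ff' _]; last exact: gluing_locusE.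
split.
- exact: pfamily_prime_uniq.
- exact: prime_pfamily_uniq.
- exact: same_pfamily_prime.
- exact: same_pfamilyP.
Qed.
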